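(* Let $A,E\in\mathbb{R}^{n,n}$ with $A$ having no eigenvalues on $\mathbb{R}^-=(-\infty,0]$, and let $h>0$ be a real parameter. 1. Consider the complex iteration $\widehat{X}_{k+1}=\tfrac{1}{2}\left(\widehat{X}_k+\widehat{X}_k^{-1}\widehat{X}_0\right)$, $\widehat{X}_0=A+ihE$. Then for all sufficiently small $h$ all iterates $\widehat{X}_k\in\mathbb{C}^{n,n}$ are nonsingular, and (i) $\lim_{k\to\infty}\mathrm{Re}(\widehat{X}_k)=A^{1/2}+\mathcal{O}(h^2)$, (ii) $\lim_{k\to\infty}\mathrm{Im}(\widehat{X}_k/h)=L_{X^{1/2}}(A,E)+\mathcal{O}(h^2)$. 2. Consider the complex iteration $$\widehat{Y}_{k+1}=\tfrac12\left(\widehat{Y}_k+\widehat{Z}_k^{-1}\right),\ \widehat{Y}_0=A+ihE,\qquad \widehat{Z}_{k+1}=\tfrac12\left(\widehat{Z}_k+\widehat{Y}_k^{-1}\right),\ \widehat{Z}_0=I_n.$$ Then for all sufficiently small $h$ all iterates $\widehat{Y}_k,\widehat{Z}_k\in\mathbb{C}^{n,n}$ are nonsingular, and (i) $\lim_{k\to\infty}\mathrm{Re}(\widehat{Y}_k)=A^{1/2}+\mathcal{O}(h^2)$, (ii) $\lim_{k\to\infty}\mathrm{Re}(\widehat{Z}_k)=A^{-1/2}+\mathcal{O}(h^2)$, (iii) $\lim_{k\to\infty}\mathrm{Im}(\widehat{Y}_k/h)=L_{X^{1/2}}(A,E)+\mathcal{O}(h^2)$, (iv) $\lim_{k\to\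infty}\mathrm{Im}(\widehat{Z}_k/h)=L_{X^{-1/2}}(A,E)+\mathcal{O}(h^2)$.
   Context: $A^{1/2}$ denotes the principal square root of $A$ (the unique square root with all eigenvalues in the open right half-plane), and $A^{-1/2}=(A^{1/2})^{-1}$. $L_{X^{1/2}}(A,E)$ and $L_{X^{-1/2}}(A,E)$ denote the Fréchet derivatives of $X\mapsto X^{1/2}$ and $X\mapsto X^{-1/2}$ at $A$ in direction $E$. $\mathrm{Re}$, $\mathrm{Im}$ are taken entrywise. A matrix-valued quantity $Q(h)$ satisfies $Q(h)=B+\mathcal{O}(h^2)$ if there is a constant $C$ with $\|Q(h)-B\|_F\le Ch^2$ as $h\to 0$. *)

(* Defs.v *)
From mathcomp Require Import all_boot all_order all_algebra.
From mathcomp Require Import all_classical all_reals all_analysis.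
From mathcomp Require Import complex.
Import GRing.Theory Num.Theory.
Local Open Scope ring_scope.
Import numFieldNormedType.Exports.
Local Open Scope classical_set_scope.

Set Implicit Arguments.
Unset Strict Implicit.
Unset Printing Implicit Defensive.

Section Defs.
Variable R : realType.
Local Notation C := (R[i]).

Definition cmx (n : nat) (A : 'M[R]_n) : 'M[C]_n :=
  map_mx (fun x : R => (x%:C)%C) A.

Definition Remx (n : nat) (X : 'M[C]_n) : 'M[R]_n := map_mx (@complex.Re R) X.
Definition Immx (n : nat) (X : 'M[C]_n) : 'M[R]_n := map_mx (@complex.Im R) X.

Definition frob (n : nat) (M : 'M[R]_n) : R :=
  Num.sqrt (\sum_(i < n) \sum_(j < n) M i j ^+ 2).

Definition is_principal_sqrt (n : nat) (M S : 'M[C]_n) : Prop :=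
  S *m S = M /\ forall z : C, eigenvalue S z -> 0 < complex.Re z.

(* the principal square root (the unique such S when it exists) *)
Definition psqrtm (n : nat) (M : 'M[C]_n) : 'M[C]_n :=
  xget 0 [set S | is_principal_sqrt M S].

Definition sqrtm (n : nat) (A : 'M[R]_n) : 'M[R]_n := Remx (psqrtm (cmx A)).
Definition invsqrtm (n : nat) (A : 'M[R]_n) : 'M[R]_n := invmx (sqrtm A).

Definition no_eig_nonpos (n : nat) (A : 'M[R]_n) : Prop :=
  forall z : C, eigenvalue (cmx A) z ->
    ~ (complex.Im z = 0 /\ complex.Re z <= 0).

Fixpoint newton_it (n : nat) (X0 : 'M[C]_n) (k : nat) : 'M[C]_n :=
  match k with
  | O => X0
  | S k' => let X := newton_it X0 k' in (2^-1 : C) *: (X + invmx X *m X0)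
  end.

Fixpoint db_it (n : nat) (Y0 : 'M[C]_n) (k : nat) : 'M[C]_n * 'M[C]_n :=
  match k with
  | O => (Y0, 1%:M)
  | S k' => let YZ := db_it Y0 k' in
      ((2^-1 : C) *: (YZ.1 + invmx YZ.2), (2^-1 : C) *: (YZ.2 + invmx YZ.1))
  end.

Definition mx_cvg (n : nat) (u : nat -> 'M[R]_n) (L : 'M[R]_n) : Prop :=
  forall i j : 'I_n, (fun k : nat => (u k i j : R)) @ \oo --> (L i j : R).

End Defs.

(* Main.v *)
Require Import Defs.
From mathcomp Require Import all_boot all_order all_algebra.
From mathcomp Require Import all_classical all_reals all_analysis.
From mathcomp Require Import complex ring lra.
Import GRing.Theory Num.Theory.
Import numFieldNormedType.Exports.
Local Open Scope ring_scope.

(* Write [S = A^(1/2)] and let [T] be the inverse of the Sylvester operator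
   [D |-> S D + D S], which is injective since the spectrum of [S] lies in the open
   right half-plane.  A square root [S + D] of [A + F] solves [D = T (F - D D)], a
   contraction for small [F]; it is again principal because its Cayley transform
   [G = (X - 1) (X + 1)^-1] keeps a power of norm less than one.  Iterating the
   equation gives [D = T F - T (T F T F) + O(|F|^3)].  For [F = i h E] the
   coefficients are real, so the quadratic term only affects the real part and the
   error of the imaginary part is [O(h^3)].  The same expansion for real [F] identifies
   the Frechet derivatives.  Finally the Newton iterates started at [X^2] are
   [X (1 + G^(2^k)) (1 - G^(2^k))^-1], which converge to [X]. *)

Import Order.TTheory Normc.

Set Implicit Arguments.
Unset Strict Implicit.
Unset Printing Implicit Defensive.

(** * The entrywise 1-norm *)

Section L1Norm.
Variable R : realType.
Local Notation C := (R[i]).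

(** This norm is submultiplicative for rectangular shapes, so it also applies to row eigenvectors,
    and it dominates the modulus of every entry. *)
Definition l1norm (m n : nat) (X : 'M[C]_(m, n)) : R :=
  \sum_(i < m) \sum_(j < n) normc (X i j).

Lemma normc_ge0 (z : C) : 0 <= normc z.
Proof. by case: z => a b; exact: sqrtr_ge0. Qed.

Lemma normcE0 : normc (0 : C) = 0.
Proof. exact: normc0. Qed.

Lemma normc_real (x : R) : normc (x%:C)%C = `|x|.
Proof. by rewrite /= expr0n addr0 sqrtr_sqr. Qed.

Lemma normRe_le (z : C) : `|complex.Re z| <= normc z.
Proof.
by case: z => a b /=; rewrite -sqrtr_sqr ler_wsqrtr // lerDl sqr_ge0.
Qed.

Lemma normIm_le (z : C) : `|complex.Im z| <= normc z.
Proof.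
by case: z => a b /=; rewrite -sqrtr_sqr ler_wsqrtr // lerDr sqr_ge0.
Qed.

Lemma normc_le (z : C) : normc z <= `|complex.Re z| + `|complex.Im z|.
Proof.
case: z => a b /=; rewrite -[leRHS]ger0_norm ?addr_ge0 // -sqrtr_sqr.
apply: ler_wsqrtr; rewrite sqrrD !real_normK ?num_real //.
by rewrite addrAC lerDl mulrn_wge0 // mulr_ge0.
Qed.

Lemma normc_sum (I : Type) (r : seq I) (P : pred I) (F : I -> C) :
  normc (\sum_(i <- r | P i) F i) <= \sum_(i <- r | P i) normc (F i).
Proof.
elim/big_rec2: _ => [|i y1 y2 _ le12]; first by rewrite normcE0.
by apply: le_trans (le_normcD _ _) _; rewrite lerD2l.
Qed.

Lemma l1norm_ge0 m n (X : 'M[C]_(m, n)) : 0 <= l1norm X.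
Proof. by do 2 apply: sumr_ge0 => ? _; exact: normc_ge0. Qed.

Lemma l1norm_entry m n (X : 'M[C]_(m, n)) i j : normc (X i j) <= l1norm X.
Proof.
rewrite /l1norm (bigD1 i) //= (bigD1 j) //= -addrA lerDl addr_ge0 //.
  by apply: sumr_ge0 => ? _; exact: normc_ge0.
by do 2 apply: sumr_ge0 => ? _; exact: normc_ge0.
Qed.

Lemma l1norm0 m n : l1norm (0 : 'M[C]_(m, n)) = 0.
Proof. by rewrite /l1norm; do 2 (rewrite big1 // => ? _); rewrite mxE normcE0. Qed.

Lemma l1norm_eq0 m n (X : 'M[C]_(m, n)) : l1norm X <= 0 -> X = 0.
Proof.
move=> X0; apply/matrixP => i j; rewrite mxE; apply: eq0_normc.
apply/eqP; rewrite eq_le normc_ge0 andbT.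
exact: le_trans (l1norm_entry X i j) X0.
Qed.

Lemma l1norm_triangle m n (X Y : 'M[C]_(m, n)) :
  l1norm (X + Y) <= l1norm X + l1norm Y.
Proof.
rewrite /l1norm -big_split ler_sum // => i _; rewrite -big_split ler_sum // => j _.
by rewrite mxE; exact: le_normcD.
Qed.

Lemma l1normN m n (X : 'M[C]_(m, n)) : l1norm (- X) = l1norm X.
Proof.
by apply: eq_bigr => i _; apply: eq_bigr => j _; rewrite mxE normcN.
Qed.

Lemma l1norm_distC m n (X Y : 'M[C]_(m, n)) : l1norm (X - Y) = l1norm (Y - X).
Proof. by rewrite -l1normN opprB. Qed.

Lemma l1normZ m n (a : C) (X : 'M[C]_(m, n)) :
  l1norm (a *: X) = normc a * l1norm X.
Proof.
rewrite /l1norm mulr_sumr; apply: eq_bigr => i _; rewrite mulr_sumr.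
by apply: eq_bigr => j _; rewrite mxE normcM.
Qed.

Lemma l1norm_sum m n (I : Type) (r : seq I) (P : pred I)
    (F : I -> 'M[C]_(m, n)) :
  l1norm (\sum_(i <- r | P i) F i) <= \sum_(i <- r | P i) l1norm (F i).
Proof.
elim/big_rec2: _ => [|i y1 y2 _ le12]; first by rewrite l1norm0.
by apply: le_trans (l1norm_triangle _ _) _; rewrite lerD2l.
Qed.

Lemma l1normM m n p (X : 'M[C]_(m, n)) (Y : 'M[C]_(n, p)) :
  l1norm (X *m Y) <= l1norm X * l1norm Y.
Proof.
rewrite /l1norm mulr_suml ler_sum // => i _.
rewrite mulr_suml; under eq_bigr do rewrite mxE.
apply: (@le_trans _ _ (\sum_(j < p) \sum_k normc (X i k) * normc (Y k j))).
  by apply: ler_sum => j _; apply: le_trans (normc_sum _ _ _) _;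
     apply: ler_sum => k _; rewrite normcM.
rewrite exchange_big ler_sum // => k _; rewrite -mulr_sumr ler_wpM2l ?normc_ge0 //.
rewrite [leRHS](bigD1 k) //= lerDl.
by do 2 apply: sumr_ge0 => ? _; exact: normc_ge0.
Qed.

Lemma l1norm_cmx n (X : 'M[R]_n) :
  l1norm (cmx X) = \sum_(i < n) \sum_(j < n) `|X i j|.
Proof.
by apply: eq_bigr => i _; apply: eq_bigr => j _; rewrite mxE normc_real.
Qed.

(** A sum of squares of nonnegative numbers is at most the square of their sum; this is used once
    over the rows and once inside each row. *)
Lemma frob_le_l1norm n (X : 'M[R]_n) : frob X <= l1norm (cmx X).
Proof.
have sum_ge0 (I : finType) (F : I -> R) : 0 <= \sum_i `|F i|.
  by apply: sumr_ge0 => *.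
have sqr_sum_le (I : finType) (F : I -> R) :
    (forall i, 0 <= F i) -> \sum_i F i ^+ 2 <= (\sum_i F i) ^+ 2.
  move=> F0; rewrite [leRHS]expr2 mulr_suml ler_sum // => i _.
  by rewrite expr2 ler_wpM2l // (bigD1 i) //= lerDl sumr_ge0.
rewrite l1norm_cmx -[leRHS]ger0_norm ?sumr_ge0 // -sqrtr_sqr.
apply: ler_wsqrtr; apply: le_trans (sqr_sum_le _ _ _) => //.
apply: ler_sum => i _; apply: le_trans (sqr_sum_le _ _ _) => //.
by apply: ler_sum => j _; rewrite real_normK ?num_real.
Qed.

Lemma norm_entry_le n (X : 'M[R]_n) i j : `|X i j| <= `|X|.
Proof.
rewrite [leRHS]mx_normrE.
exact: (le_bigmax_cond _ (fun ij => `|X ij.1 ij.2|) (j := (i, j))).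
Qed.

(** One half of the equivalence with the max norm, in which differentials are expressed;
    [norm_le_l1norm_cmx] is the other half. *)
Lemma l1norm_cmx_le n (X : 'M[R]_n) : l1norm (cmx X) <= (n ^ 2)%:R * `|X|.
Proof.
rewrite l1norm_cmx; apply: (@le_trans _ _ (\sum_(i < n) \sum_(j < n) `|X|)).
  by apply: ler_sum => i _; apply: ler_sum => j _; exact: norm_entry_le.
by rewrite !sumr_const card_ord -mulrnA mulr_natl.
Qed.

Lemma norm_le_l1norm_cmx n (X : 'M[R]_n) : `|X| <= l1norm (cmx X).
Proof.
rewrite [leLHS]mx_normrE; apply: bigmax_le => [|[i j] _ /=].
  exact: l1norm_ge0.
by rewrite -normc_real; apply: le_trans (l1norm_entry (cmx X) i j); rewrite mxE.
Qed.

Lemma l1norm_cmx_Re n (X : 'M[C]_n) : l1norm (cmx (Remx X)) <= l1norm X.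
Proof.
by rewrite l1norm_cmx; do 2 apply: ler_sum => ? _; rewrite mxE normRe_le.
Qed.

Lemma l1norm_cmx_Im n (X : 'M[C]_n) : l1norm (cmx (Immx X)) <= l1norm X.
Proof.
by rewrite l1norm_cmx; do 2 apply: ler_sum => ? _; rewrite mxE normIm_le.
Qed.

End L1Norm.

(** * Eigenvalues, Sylvester equations and principal square roots *)

Section MatrixAlgebra.
Variable F : fieldType.

Lemma eigenvalueNunit n (X : 'M[F]_n) z :
  eigenvalue X z = (X - z%:M \notin unitmx).
Proof. by rewrite /eigenvalue kermx_eq0 row_free_unit. Qed.

Lemma unitmx_rowinj n (X : 'M[F]_n) :
  (forall v : 'rV[F]_n, v *m X = 0 -> v = 0) -> X \in unitmx.
Proof.
move=> injX; rewrite -row_free_unit -kermx_eq0; apply/rowV0P => v.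
by rewrite sub_kermx => /eqP /injX.
Qed.

Lemma unitmx_eigenvalue0 n (X : 'M[F]_n) : ~~ eigenvalue X 0 -> X \in unitmx.
Proof. by rewrite eigenvalueNunit negbK raddf0 subr0. Qed.

Lemma invmx_uniq n (X Y : 'M[F]_n) : X *m Y = 1%:M -> invmx X = Y.
Proof.
move=> XY1; have [uX _] := mulmx1_unit XY1.
by rewrite -[RHS](mulKmx uX) XY1 mulmx1.
Qed.

Lemma exprSmx n (X : 'M[F]_n) k : X ^+ k.+1 = X *m X ^+ k.
Proof. by rewrite exprS. Qed.

Lemma exprSrmx n (X : 'M[F]_n) k : X ^+ k.+1 = X ^+ k *m X.
Proof. by rewrite exprSr. Qed.

Lemma comm_mx_inv n (X Y : 'M[F]_n) :
  X \in unitmx -> comm_mx X Y -> comm_mx (invmx X) Y.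
Proof.
move=> uX cXY; rewrite /comm_mx -[LHS](mulmxK uX) -(mulmxA _ Y) -cXY.
by rewrite mulmxA mulVmx // mul1mx.
Qed.

Lemma comm_mx_subscalar n (X Y : 'M[F]_n) z :
  comm_mx X Y -> comm_mx X (Y - z%:M).
Proof. by move=> cXY; apply: comm_mxB => //; exact: comm_mx_scalar. Qed.

Lemma comm_mx_exp n (X Y : 'M[F]_n) k : comm_mx X Y -> comm_mx X (Y ^+ k).
Proof.
move=> cXY; elim: k => [|k IH]; first by rewrite expr0; exact: comm_mx1.
by rewrite exprSmx; apply: comm_mxM.
Qed.

(** An injective endomorphism of a finite-dimensional space is bijective. The inverse is taken on
    vectorised matrices and returned as a bundled linear map, so that it can later serve as a
    differential. *)
Lemma sylvester_solve n (X Y : 'M[F]_n) :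
  (forall D : 'M[F]_n, X *m D + D *m Y = 0 -> D = 0) ->
  exists T : {linear 'M[F]_n -> 'M[F]_n}, forall W, X *m T W + T W *m Y = W.
Proof.
move=> inj; pose f : {linear 'M[F]_n -> 'M[F]_n} := mulmx X \+ mulmxr Y.
have uf : lin_mx f \in unitmx.
  apply: unitmx_rowinj => v; rewrite mul_rV_lin => /(congr1 vec_mx).
  by rewrite mxvecK linear0 => /inj /(congr1 mxvec); rewrite vec_mxK linear0.
exists (vec_mx \o mulmxr (invmx (lin_mx f)) \o mxvec) => W /=.
set V := vec_mx _; rewrite -[LHS]/(f V) -[f V]mxvecK -mul_vec_lin.
by rewrite /V vec_mxK mulmxKV // mxvecK.
Qed.

End MatrixAlgebra.

(** * Spectral arguments over an algebraically closed field *)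

Section ClosedMatrixAlgebra.
Variable F : closedFieldType.

(** Cayley-Hamilton with the characteristic polynomial split into linear factors. Induction along
    this list of factors takes the place of a Jordan form below. *)
Lemma eigenvalue_annihilates n (X : 'M[F]_n) : exists2 rs : seq F,
  (forall z, z \in rs -> eigenvalue X z) &
  \prod_(z <- rs) (X - z%:M) = 0.
Proof.
case: n X => [|n] X; first by exists [::] => //; exact: flatmx0.
have [rs] := closed_field_poly_normal (char_poly X).
rewrite (monicP (char_poly_monic X)) scale1r => charX; exists rs => [z zrs|].
  by rewrite eigenvalue_root_char charX root_prod_XsubC.
rewrite -[RHS](Cayley_Hamilton X) charX rmorph_prod; apply: eq_bigr => z _.
by rewrite /= rmorphB /= horner_mx_X horner_mx_C.
Qed.

(** Induction on the factors annihilating [D]. Since [X - z] commutes with [X], the matrix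
    [(X - z) D] solves the same equation and vanishes by induction. Then [X D = z D], so
    [D (Y + z) = 0], and [Y + z] is invertible. *)
Lemma sylvester_inj n (X Y D : 'M[F]_n) :
  (forall z, eigenvalue X z -> ~~ eigenvalue Y (- z)) ->
  X *m D + D *m Y = 0 -> D = 0.
Proof.
move=> disj; have [rs rsX prod0] := eigenvalue_annihilates X.
have: forall z, z \in rs -> ~~ eigenvalue Y (- z) by move=> z /rsX /disj.
have: (\prod_(z <- rs) (X - z%:M)) *m D = 0 by rewrite prod0 mul0mx.
elim/last_ind: rs {rsX prod0} D => [|rs z IH] D.
  by rewrite big_nil mul1mx.
rewrite big_rcons /= => prodD disj' XD.
set D1 := (X - z%:M) *m D.
have D1_0 : D1 = 0.
  apply: IH => [|y yrs|]; first by rewrite mulmxA.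
    by apply: disj'; rewrite mem_rcons inE yrs orbT.
  rewrite /D1 mulmxA (comm_mx_subscalar z (erefl (X *m X))) -!mulmxA -mulmxDr.
  by rewrite XD mulmx0.
have : D *m (Y - (- z)%:M) = 0.
  have DY : D *m Y = - (X *m D) by apply/eqP; rewrite -addr_eq0 addrC XD.
  rewrite raddfN opprK mulmxDr mul_mx_scalar DY; move: D1_0.
  by rewrite /D1 mulmxBl mul_scalar_mx => /subr0_eq ->; rewrite addNr.
have: ~~ eigenvalue Y (- z) by apply: disj'; rewrite mem_rcons inE eqxx.
rewrite eigenvalueNunit negbK => uY DY0.
by rewrite -(mulmxK uY D) DY0 mul0mx.
Qed.

(* Each step adds [c * prod_(z in rs) ('X - z)] to the polynomial; [c] is fixed by
   interpolation at a new root, and by a Hensel step at a repeated one. *)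
Lemma poly_sqrt_mod_prod (s : F -> F) (rs : seq F) :
  2%:R != 0 :> F -> (forall z, z \in rs -> s z ^+ 2 = z /\ s z != 0) ->
  exists p q : {poly F}, p ^+ 2 - 'X = q * \prod_(z <- rs) ('X - z%:P) /\
    forall z, z \in rs -> p.[z] = s z.
Proof.
move=> nz2; elim: rs => [|z rs IH] srs.
  by exists 0, (- 'X); rewrite big_nil expr0n sub0r mulr1; split.
have [y yrs|p [r [pE ps]]] := IH; first by apply: srs; rewrite inE yrs orbT.
have [sz2 sz0] : s z ^+ 2 = z /\ s z != 0 by apply: srs; rewrite inE eqxx.
rewrite big_cons; set P := \prod_(y <- rs) _ in pE *.
have rootPE y : (P.[y] == 0) = (y \in rs).
  by rewrite -rootE /P root_prod_XsubC.
have P0 y : y \in rs -> P.[y] = 0 by rewrite -rootPE => /eqP.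
pose c := if z \in rs then - r.[z] / (2%:R * s z) else (s z - p.[z]) / P.[z].
pose p' := p + c *: P; pose g := r + (2%:R * c) *: p + c ^+ 2 *: P.
have pgE : p' ^+ 2 - 'X = g * P.
  have p2E : p ^+ 2 = r * P + 'X by rewrite -pE subrK.
  have -> : p' ^+ 2 = p ^+ 2 + (2%:R * c) *: p * P + c ^+ 2 *: P * P.
    rewrite /p' -!mul_polyC polyC_exp polyCM polyC_natr; ring.
  rewrite p2E /g -!mul_polyC; ring.
(* At a repeated root [P.[z] = 0], and [g.[z]] reduces to [r.[z] + 2 c s(z)], which [c] cancels. At
   a new root [g.[z] * P.[z] = s(z)^2 - z = 0] with [P.[z]] nonzero. *)
have g0 : g.[z] = 0.
  rewrite /g /c !hornerE; case: ifP => zrs.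
    by rewrite (P0 z zrs) (ps z zrs); field; rewrite sz0.
  have Pz : P.[z] != 0 by rewrite rootPE zrs.
  move: (congr1 (horner^~ z) pgE); rewrite /g /p' /c zrs !hornerE /= => e.
  apply: (mulIf Pz); rewrite mul0r -{}e.
  by rewrite mulfVK // subrKC sz2 subrr.
have /factor_theorem[g' gE] : root g z by apply/rootP.
exists p', g'; split; first by rewrite pgE gE mulrA.
move=> y; rewrite inE => /predU1P[->|yrs]; last first.
  by rewrite /p' !hornerE (P0 y yrs) mulr0 addr0 ps.
rewrite /p' /c !hornerE; case: ifP => zrs.
  by rewrite (P0 z zrs) mulr0 addr0 ps.
by rewrite mulfVK ?subrKC // rootPE zrs.
Qed.

(** The root is a polynomial [p] in [X], where [p^2 - 'X] is a multiple of a polynomial annihilating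
    [X] and [p] takes the prescribed values [s] on the spectrum. *)
Lemma sqrtmx_exists (s : F -> F) n (X : 'M[F]_n) :
  2%:R != 0 :> F -> (forall z, eigenvalue X z -> s z ^+ 2 = z /\ s z != 0) ->
  exists S, S *m S = X /\
    forall z, eigenvalue S z -> exists2 y, eigenvalue X y & z = s y.
Proof.
case: n X => [|n] X nz2 sX.
  exists 0; split=> [|z]; first by rewrite [RHS]flatmx0; exact: flatmx0.
  by rewrite eigenvalueNunit unitmxE det_mx00 unitr1.
have [rs rsX prod0] := eigenvalue_annihilates X.
have [|p [q [pE ps]]] := @poly_sqrt_mod_prod s rs nz2.
  by move=> z /rsX /sX.
have P0 : horner_mx X (\prod_(z <- rs) ('X - z%:P)) = 0.
  rewrite -prod0 rmorph_prod; apply: eq_bigr => z _.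
  by rewrite /= rmorphB /= horner_mx_X horner_mx_C.
exists (horner_mx X p); split=> [|z].
  have -> : horner_mx X p *m horner_mx X p = horner_mx X ('X + (p ^+ 2 - 'X)).
    by rewrite subrKC expr2 rmorphM.
  by rewrite pE rmorphD rmorphM /= P0 mulr0 addr0 horner_mx_X.
(* If [z] is none of the values [p.[y]], then [p - z] is coprime to the annihilating product, and a
   Bezout relation evaluated at [X] inverts [p(X) - z]. *)
have [/hasP[y yrs /eqP->] _|/hasPn Nz] := boolP (has (fun y => z == p.[y]) rs).
  by exists y; [exact: rsX | exact: ps].
rewrite eigenvalueNunit => /negP[].
have : coprimep (p - z%:P) (\prod_(z <- rs) ('X - z%:P)).
  elim: (rs) Nz => [|y r IH] Nz; first by rewrite big_nil coprimep1.
  rewrite big_cons coprimepMr coprimep_XsubC IH ?andbT.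
    by rewrite rootE !hornerE subr_eq0 eq_sym Nz // mem_head.
  by move=> x xr; apply: Nz; rewrite inE xr orbT.
move=> /Bezout_eq1_coprimepP[[u v]] /= /(congr1 (horner_mx X)).
rewrite rmorphD !rmorphM /= P0 mulr0 addr0 rmorphB /= horner_mx_C rmorph1.
by move=> /mulmx1_unit[].
Qed.
End ClosedMatrixAlgebra.

(** * Principal square roots: existence, uniqueness, reality *)

Section PrincipalSqrt.
Variable R : realType.
Local Notation C := (R[i]).

Lemma complex_sqrt (z : C) : ~ (complex.Im z = 0 /\ complex.Re z <= 0) ->
  exists w, w ^+ 2 = z /\ 0 < complex.Re w.
Proof.
move=> zN; have := sqr_sqrtc z; set w := sqrtc z => w2.
have [w0|w0|w0] := ltgtP (complex.Re w) 0; last first.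
- case: zN; rewrite -w2 expr2; case: w w0 {w2} => a b /= ->.
  by rewrite !mul0r mulr0 addr0 sub0r oppr_le0 -expr2 sqr_ge0.
- by exists w.
- by exists (- w); rewrite sqrrN raddfN oppr_gt0.
Qed.

Lemma principal_sqrt_exists n (X : 'M[C]_n) :
  (forall z, eigenvalue X z -> ~ (complex.Im z = 0 /\ complex.Re z <= 0)) ->
  exists S, is_principal_sqrt X S.
Proof.
move=> specX.
pose P z (w : C) := w ^+ 2 = z /\ 0 < complex.Re w.
pose s z := xget 0 (fun w => P z w).
have sP z : eigenvalue X z -> P z (s z).
  by move=> /specX /complex_sqrt [w Pw]; apply: xgetPex; exists w.
have [|z /sP[sz2 sz0]|S [S2 specS]] := @sqrtmx_exists _ s n X.
- by rewrite pnatr_eq0.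
- by split=> //; apply: contraTneq sz0 => ->; rewrite /= ltxx.
by exists S; split=> [|z /specS[y /sP[_ Rey] ->]]; [exact: S2 | exact: Rey].
Qed.

Lemma principal_sylvester_inj n (X Y S T D : 'M[C]_n) :
  is_principal_sqrt X S -> is_principal_sqrt Y T ->
  S *m D + D *m T = 0 -> D = 0.
Proof.
move=> [_ specS] [_ specT]; apply: sylvester_inj => z /specS z0.
by apply/negP => /specT; rewrite raddfN oppr_gt0 ltNge ltW.
Qed.

(** The difference [D = S - T] satisfies [S D + D T = S^2 - T^2 = 0]. *)
Lemma principal_sqrt_uniq n (X S T : 'M[C]_n) :
  is_principal_sqrt X S -> is_principal_sqrt X T -> S = T.
Proof.
move=> pS pT; apply/subr0_eq; apply: (principal_sylvester_inj pS pT).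
rewrite mulmxBr mulmxBl; case: pS => -> _; case: pT => -> _.
by rewrite addrA subrK subrr.
Qed.

Lemma psqrtmP n (X S : 'M[C]_n) : is_principal_sqrt X S -> psqrtm X = S.
Proof.
by move=> pS; apply: principal_sqrt_uniq (pS); exact: (xgetPex 0 (ex_intro _ S pS)).
Qed.

Lemma principal_sqrt_unit n (X S : 'M[C]_n) :
  is_principal_sqrt X S -> S \in unitmx.
Proof.
move=> [_ specS]; apply: unitmx_eigenvalue0.
by apply/negP => /specS; rewrite /= ltxx.
Qed.

(** The entrywise conjugate of [S] is again a principal square root of the real matrix, so
    uniqueness makes [S] real. Hence taking real parts in [sqrtm] loses nothing. *)
Lemma principal_sqrt_real n (X : 'M[R]_n) (S : 'M[C]_n) :
  is_principal_sqrt (cmx X) S -> cmx (Remx S) = S.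
Proof.
move=> pS; have conjX : map_mx (@conjc R) (cmx X) = cmx X.
  by apply/matrixP => i j; rewrite !mxE conjc_real.
have : is_principal_sqrt (cmx X) (map_mx (@conjc R) S).
  case: pS => S2 specS; split; first by rewrite -map_mxM S2 conjX.
  move=> z; rewrite -[z]conjcK eigenvalue_map => /specS.
  by case: (z).
move=> /(principal_sqrt_uniq pS) SE; apply/matrixP => i j; rewrite !mxE.
rewrite [RHS]complexE; suff -> : complex.Im (S i j) = 0 by rewrite mulr0 addr0.
have /(congr1 (@complex.Im R)) : S i j = (S i j)^*%C by rewrite {1}SE mxE.
by case: (S i j) => a b /= /eqP; rewrite -addr_eq0 -mulr2n mulrn_eq0 /= => /eqP.
Qed.

Lemma sqrtmE n (X : 'M[R]_n) (S : 'M[C]_n) :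
  is_principal_sqrt (cmx X) S -> cmx (sqrtm X) = S.
Proof. by move=> pS; rewrite /sqrtm (psqrtmP pS) (principal_sqrt_real pS). Qed.

End PrincipalSqrt.

(** * Convergence of the Newton iteration *)

Section Newton.
Variable R : realType.
Local Notation C := (R[i]).

Lemma geometric_eventually_lt (c r e : R) : 0 <= r < 1 -> 0 < e ->
  exists N, forall k, (N <= k)%N -> c * r ^+ k < e.
Proof.
move=> /andP[r0 r1] e0.
have /cvgrPdist_lt/(_ _ e0) : (geometric c r @ \oo --> (0 : R))%classic.
  by apply: cvg_geometric; rewrite ger0_norm.
move=> [N _ HN]; exists N => k Nk; have := HN k Nk.
by rewrite /= sub0r normrN => /(le_lt_trans (ler_norm _)).
Qed.

(** Replaces the spectral radius formula. Factors [G - z] are removed one at a time: if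
    [G^k (G - z) V] is [O(r^k)], then [V_k = G^k V] satisfies [V_(k+1) = z V_k + O(r^k)] and decays
    at any rate [s] above both [r] and [|z|]. *)
Lemma powers_decay n (G : 'M[C]_n) :
  (forall z, eigenvalue G z -> normc z < 1) ->
  exists c r, [/\ 0 <= c, 0 <= r < 1 & forall k, l1norm (G ^+ k) <= c * r ^+ k].
Proof.
move=> specG; have [rs rsG prod0] := eigenvalue_annihilates G.
have rs1 z : z \in rs -> normc z < 1 by move=> /rsG /specG.
suff decay (V : 'M[C]_n) : (\prod_(z <- rs) (G - z%:M)) *m V = 0 ->
    exists c r, [/\ 0 <= c, 0 <= r < 1 &
                    forall k, l1norm (G ^+ k *m V) <= c * r ^+ k].
  have [|c [r [c0 r01 Gk]]] := decay 1%:M; first by rewrite prod0 mul0mx.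
  by exists c, r; split=> // k; rewrite -[G ^+ k]mulmx1.
elim/last_ind: rs rs1 {rsG prod0} V => [|rs z IH] rs1 V.
  rewrite big_nil mul1mx => ->; exists 0, 0; split; rewrite ?lexx ?ltr01 // => k.
  by rewrite mulmx0 l1norm0 mul0r.
rewrite big_rcons /= -mulmxA => /IH[y yrs|c [r [c0 /andP[r0 r1] Uk]]].
  by apply: rs1; rewrite mem_rcons inE yrs orbT.
have z1 : normc z < 1 by apply: rs1; rewrite mem_rcons inE eqxx.
pose s := (1 + Num.max r (normc z)) / 2.
have maxlt : Num.max r (normc z) < 1 by rewrite gt_max r1 z1.
have rmax : r <= Num.max r (normc z) by rewrite le_max lexx.
have zmax : normc z <= Num.max r (normc z) by rewrite le_max lexx orbT.
have rs' : r <= s by rewrite /s; lra.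
have zs : normc z < s by rewrite /s; lra.
have s1 : s < 1 by rewrite /s; lra.
have d0 : 0 < s - normc z by rewrite subr_gt0.
(* The first bound starts the induction; the second gives [|z| c' s^k + c r^k <= c' s^(k+1)]. *)
pose c' := Num.max (l1norm V) (c / (s - normc z)).
have c'V : l1norm V <= c' by rewrite le_max lexx.
have c'c : c <= c' * (s - normc z).
  by rewrite -ler_pdivrMr // le_max lexx orbT.
exists c', s; split; first exact: le_trans (l1norm_ge0 V) c'V.
  by rewrite s1 (le_trans r0).
elim=> [|k IHk]; first by rewrite !expr0 mul1mx mulr1.
have -> : G ^+ k.+1 *m V = z *: (G ^+ k *m V) + G ^+ k *m ((G - z%:M) *m V).
  by rewrite mulmxBl mulmxBr mul_scalar_mx -scalemxAr subrKC exprSrmx mulmxA.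
apply: le_trans (l1norm_triangle _ _) _; rewrite l1normZ.
apply: (@le_trans _ _ (normc z * (c' * s ^+ k) + c' * (s - normc z) * s ^+ k)).
  rewrite lerD //; first by rewrite ler_wpM2l ?normc_ge0.
  apply: le_trans (Uk k) _; apply: ler_pM => //; first exact: exprn_ge0.
  by apply: lerXn2r; rewrite ?nnegrE // (le_trans r0).
by rewrite exprS le_eqVlt; apply/orP; left; apply/eqP; ring.
Qed.

(** The Moebius map [(x - 1) / (x + 1)] carries the open right half-plane onto the open unit disc,
    so that principality turns into decay of powers. *)
Definition cayley n (X : 'M[C]_n) := (X - 1%:M) *m invmx (X + 1%:M).

Lemma Re_gt0_normc (z : C) : (0 < complex.Re z) = (normc (z - 1) < normc (z + 1)).
Proof.
case: z => a b /=; rewrite oppr0 !addr0.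
case: (ltP 0 a) => a0; apply/esym.
  by rewrite ltr_sqrt; have := sqr_ge0 b; [nra|nra].
by apply/negbTE; rewrite -leNgt ler_wsqrtr //; nra.
Qed.

Lemma principal_addr1_unit n (X : 'M[C]_n) :
  (forall z, eigenvalue X z -> 0 < complex.Re z) -> X + 1%:M \in unitmx.
Proof.
move=> specX; have : ~~ eigenvalue X (-1).
  by apply/negP => /specX /=; rewrite oppr_gt0 ltr10.
by rewrite eigenvalueNunit negbK raddfN opprK.
Qed.

(** An eigenvector of the transform for [g] is an eigenvector of [X] for the preimage
    [(1 + g) / (1 - g)]. *)
Lemma cayley_eigenvalue n (X : 'M[C]_n) g :
  (forall z, eigenvalue X z -> 0 < complex.Re z) ->
  eigenvalue (cayley X) g -> normc g < 1.
Proof.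
move=> specX; have uX := principal_addr1_unit specX.
move=> /eigenvalueP[v /(congr1 (mulmx^~ (X + 1%:M)))].
rewrite /cayley mulmxA mulmxKV // mulmxBr mulmx1 -scalemxAl mulmxDr mulmx1.
rewrite scalerDr => vX v0.
have {}vX : (1 - g) *: (v *m X) = (1 + g) *: v.
  rewrite scalerBl scale1r scalerDl scale1r.
  have vXE : v *m X = g *: (v *m X) + g *: v + v by rewrite -vX subrK.
  by rewrite {1}vXE addrC !addrA addNr add0r addrC.
(* For [g = 1] the relation [vX] would read [0 = 2 v]. *)
have g1 : 1 - g != 0.
  apply: contraNneq v0 => g1; move: vX; rewrite g1 scale0r => /esym/eqP.
  rewrite scaler_eq0 => /orP[|//].
  by rewrite -(subr0_eq g1) -mulr2n pnatr_eq0.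
pose z := (1 + g) / (1 - g).
have /specX : eigenvalue X z.
  apply/eigenvalueP; exists v => //; apply: (scalerI g1).
  by rewrite vX scalerA mulrC divfK.
rewrite Re_gt0_normc => z1.
have gz : g * (z + 1) = z - 1 by rewrite /z; field.
rewrite -gz normcM in z1.
have zp : 0 < normc (z + 1).
  rewrite lt_neqAle normc_ge0 andbT; apply: contraTneq z1 => <-.
  by rewrite mulr0 ltxx.
by move: z1; rewrite gtr_pMl.
Qed.

(** A converse that asks for one small power only, a condition that survives small perturbations of
    [X]. *)
Lemma eigenvalue_cayley n (X : 'M[C]_n) N z : X + 1%:M \in unitmx ->
  l1norm (cayley X ^+ N) < 1 -> eigenvalue X z -> 0 < complex.Re z.
Proof.
move=> uX GN /eigenvalueP[v vX v0]; rewrite Re_gt0_normc.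
have vX1 : v *m (X + 1%:M) = (z + 1) *: v.
  by rewrite mulmxDr vX mulmx1 scalerDl scale1r.
have z1 : z + 1 != 0.
  apply: contraNneq v0 => z1; move: vX1; rewrite z1 scale0r => vX1.
  by rewrite -(mulmxK uX v) vX1 mul0mx.
pose g := (z - 1) / (z + 1).
have vG : v *m cayley X = g *: v.
  rewrite /cayley mulmxA mulmxBr vX mulmx1 -[in X in _ - X](scale1r v) -scalerBl.
  apply: (can_inj (mulmxK uX)).
  by rewrite mulmxKV // -scalemxAl vX1 scalerA /g divfK.
have vGk k : v *m cayley X ^+ k = g ^+ k *: v.
  elim: k => [|k IH]; first by rewrite !expr0 mulmx1 scale1r.
  by rewrite exprSrmx mulmxA IH -scalemxAl vG scalerA -exprSr.
have vnorm : 0 < l1norm v.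
  rewrite lt_neqAle l1norm_ge0 andbT; apply: contraNneq v0 => v0.
  by apply/eqP; apply: l1norm_eq0; rewrite -v0.
have normcX k : normc (g ^+ k) = normc g ^+ k.
  by elim: k => [|k IH]; rewrite ?expr0 ?normc1 // !exprS normcM IH.
have : normc g ^+ N < 1.
  rewrite -(ltr_pM2r vnorm) mul1r -normcX -l1normZ -vGk.
  apply: le_lt_trans (l1normM _ _) _.
  by rewrite -[ltRHS]mulr1 ltr_pM2l.
move=> gN; have g1 : normc g < 1.
  by rewrite ltNge; apply: contraTN gN => g1'; rewrite -leNgt exprn_ege1.
have -> : z - 1 = g * (z + 1) by rewrite /g divfK.
rewrite normcM gtr_pMl ?g1 // lt_neqAle normc_ge0 andbT.
by apply: contra_neq z1 => /esym /eq0_normc.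
Qed.

(** A row vector fixed or negated by [G^m] keeps its norm under all powers of [G^m], against the
    decay; [m > 0] makes these powers run to infinity. *)
Lemma decay_unit n (G : 'M[C]_n) c r m : (0 < m)%N -> 0 <= r < 1 ->
  (forall k, l1norm (G ^+ k) <= c * r ^+ k) ->
  1%:M - G ^+ m \in unitmx /\ 1%:M + G ^+ m \in unitmx.
Proof.
move=> m0 r01 Gk.
have [N HN] := geometric_eventually_lt c r01 ltr01.
have inj (v : 'rV[C]_n) (e : C) : normc e = 1 -> v *m G ^+ m = e *: v -> v = 0.
  move=> e1 vG.
  have vGk k : l1norm (v *m (G ^+ m) ^+ k) = l1norm v.
    elim: k => [|k IH]; first by rewrite expr0 mulmx1.
    by rewrite exprSmx mulmxA vG -scalemxAl l1normZ e1 mul1r.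
  apply: l1norm_eq0; rewrite leNgt; apply/negP => v0.
  have := l1normM v ((G ^+ m) ^+ N); rewrite vGk -exprM.
  rewrite leNgt -[ltRHS]mulr1 ltr_pM2l // => /negP; apply.
  apply: le_lt_trans (Gk _) _; apply: HN.
  by rewrite leq_pmull.
split; apply: unitmx_rowinj => v.
  rewrite mulmxBr mulmx1 => /esym/eqP; rewrite eq_sym subr_eq0 eq_sym => /eqP vG.
  by apply: (inj v 1); rewrite ?normc1 ?scale1r.
rewrite mulmxDr mulmx1 addrC => /eqP; rewrite addr_eq0 => /eqP vG.
by apply: (inj v (-1)); rewrite ?normcN ?normc1 // scaleN1r.
Qed.

(* With [G] the Cayley transform of the limit [X], the iterates are
   [X (1 + G^(2^k)) (1 - G^(2^k))^-1]. *)
Lemma newton_closed_form n (M X : 'M[C]_n) k : is_principal_sqrt M X ->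
  newton_it M k \in unitmx /\
  newton_it M k *m (1%:M - cayley X ^+ (2 ^ k)) = X *m (1%:M + cayley X ^+ (2 ^ k)).
Proof.
move=> pX; have [X2 specX] := pX; have uX := principal_sqrt_unit pX.
have uX1 := principal_addr1_unit specX.
have [c [r [_ r01 Gk]]] := powers_decay (fun g => @cayley_eigenvalue n X g specX).
set G := cayley X in Gk *.
have GX : G *m (X + 1%:M) = X - 1%:M by rewrite /G mulmxKV.
have cXG : comm_mx X G.
  apply: comm_mxM; first by apply: comm_mxB => //; exact: comm_mx1.
  apply/comm_mx_sym/comm_mx_inv => //; apply/comm_mx_sym/comm_mxD => //.
  exact: comm_mx1.
have units j := decay_unit (expn_gt0 2 j) r01 Gk.
elim: k => [|k [uXk IH]].
  split; first by rewrite /= -X2 unitmx_mul uX.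
  rewrite /= expr1 -X2 -mulmxA; congr (_ *m _).
  (* The case [k = 0] amounts to [X (1 - G) = 1 + G], checked after multiplication by the unit
     [X + 1]. *)
  have two : X *m (1%:M - G) *m (X + 1%:M) = (1%:M + G) *m (X + 1%:M).
    rewrite -mulmxA mulmxBl mulmxDl !mul1mx GX.
    have -> : X + 1%:M - (X - 1%:M) = 2%:R *: 1%:M.
      by apply/matrixP => i j; rewrite !mxE; ring.
    by rewrite -scalemxAr mulmx1; apply/matrixP => i j; rewrite !mxE; ring.
  by rewrite -[LHS](mulmxK uX1) two mulmxK.
have [uV uU] := units k; have [uV' _] := units k.+1.
set P := G ^+ (2 ^ k) in uU uV IH *; set Xk := newton_it M k in uXk IH *.
have P2 : G ^+ (2 ^ k.+1) = P *m P by rewrite expnS mulnC exprM expr2.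
have cXP : comm_mx X P by exact: comm_mx_exp.
set U := 1%:M + P in uU IH *; set V := 1%:M - P in uV IH *.
have cXU : comm_mx X U by apply: comm_mxD => //; exact: comm_mx1.
have cVX : comm_mx V X.
  by apply/comm_mx_sym/comm_mxB => //; exact: comm_mx1.
have cUV : comm_mx U V.
  by apply: comm_mxB; [exact: comm_mx1 | apply/comm_mx_sym/comm_mxD => //; exact: comm_mx1].
have VU : 1%:M - G ^+ (2 ^ k.+1) = V *m U.
  by rewrite P2 /V /U mulmxDr mulmx1 mulmxBl mul1mx addrA subrK.
have XkV : invmx Xk *m (X *m U) = V by rewrite -IH mulKmx.
(* With [1 - P^2 = V U], the recurrence reduces to [U^2 + V^2 = 2 (1 + P^2)]. *)
have step : newton_it M k.+1 *m (1%:M - G ^+ (2 ^ k.+1)) =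
            X *m (1%:M + G ^+ (2 ^ k.+1)).
  rewrite VU P2 /= -/Xk -scalemxAl mulmxDl -X2.
  have -> : Xk *m (V *m U) = X *m (U *m U) by rewrite (mulmxA Xk) IH -mulmxA.
  have -> : invmx Xk *m (X *m X) *m (V *m U) = X *m (V *m V).
    have E : X *m X *m (V *m U) = X *m U *m (X *m V).
      by rewrite -cUV -!mulmxA; congr (X *m _); rewrite !mulmxA cXU.
    by rewrite -(mulmxA (invmx Xk)) E (mulmxA (invmx Xk)) XkV (mulmxA V) cVX -mulmxA.
  rewrite -mulmxDr scalemxAr; congr (_ *m _).
  have -> : U *m U + V *m V = 2%:R *: (1%:M + P *m P).
    rewrite /U /V !(mulmxBl, mulmxBr, mulmxDl, mulmxDr, mul1mx, mulmx1, mulNmx, mulmxN).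
    by apply/matrixP => i j; move: (P *m P) => Q; rewrite !mxE; ring.
  by rewrite scalerA mulVf ?scale1r // pnatr_eq0.
(* All other factors in [step] are units, hence so is the new iterate. *)
split=> //; have := congr1 (fun Z => Z \in unitmx) step.
have [_ uU'] := units k.+1.
by rewrite !unitmx_mul uV' uU' uX andbT.
Qed.

Lemma newton_it_unit n (M X : 'M[C]_n) k :
  is_principal_sqrt M X -> newton_it M k \in unitmx.
Proof. by move=> /(newton_closed_form k)[]. Qed.

(** With [P = G^(2^k)] the closed form reads [X_k - X = 2 X P + (X_k - X) P]; once [|P| < 1/2] the
    last term is absorbed on the left. *)
Lemma newton_cvg n (M X : 'M[C]_n) : is_principal_sqrt M X ->
  (l1norm (newton_it M k - X) @[k --> \oo] --> (0 : R))%classic.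
Proof.
move=> pX; have [_ specX] := pX.
have [c [r [c0 r01 Gk]]] := powers_decay (fun g => @cayley_eigenvalue n X g specX).
have half0 : (0 : R) < 2^-1 by rewrite invr_gt0.
have [N HN] := geometric_eventually_lt c r01 half0.
have [r0 r1] := andP r01.
apply: (@squeeze_cvgr _ _ _ _ (fun=> 0) (fun k => 4 * l1norm X * c * r ^+ k)).
- exists N => // k /= Nk; rewrite l1norm_ge0 /=.
  have [_] := newton_closed_form k pX.
  set G := cayley X in Gk *; set P := G ^+ (2 ^ k); set Xk := newton_it M k => Xkk.
  have Nk2 : (N <= 2 ^ k)%N by apply: leq_trans Nk _; exact/ltnW/ltn_expl.
  have Phalf : l1norm P < 2^-1 := le_lt_trans (Gk _) (HN _ Nk2).
  (* The exponent [2^k] is weakened to [k], which suffices for convergence. *)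
  have Pk : l1norm P <= c * r ^+ k.
    apply: le_trans (Gk _) _; rewrite ler_wpM2l // ler_wiXn2l ?(ltW r1) //.
    exact/ltnW/ltn_expl.
  have E : Xk - X = 2%:R *: (X *m P) + (Xk - X) *m P.
    move: Xkk; rewrite !(mulmxBl, mulmxBr, mulmxDr, mulmx1).
    move=> /eqP; rewrite subr_eq => /eqP {1}->.
    by apply/matrixP => i j; move: (X *m P) (Xk *m P) => Q Q'; rewrite !mxE; ring.
  have : l1norm (Xk - X) <= 2 * (l1norm X * l1norm P) + l1norm (Xk - X) * l1norm P.
    rewrite {1}E; apply: le_trans (l1norm_triangle _ _) _.
    by rewrite l1normZ -(rmorph_nat (real_complex R)) normc_real normr_nat lerD
      ?ler_wpM2l ?l1normM.
  have : l1norm (Xk - X) * l1norm P <= l1norm (Xk - X) * 2^-1.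
    by rewrite ler_wpM2l ?l1norm_ge0 // ltW.
  have : l1norm X * l1norm P <= l1norm X * (c * r ^+ k).
    by rewrite ler_wpM2l ?l1norm_ge0.
  by rewrite -!mulrA; lra.
- exact: cvg_cst.
- by apply: cvg_geometric; rewrite ger0_norm.
Qed.

(* For [Z_0 = 1] the second Denman--Beavers sequence is [Y0^-1 Y_k], and the first
   one is the Newton sequence. *)
Lemma db_it_newton n (Y X : 'M[C]_n) k : is_principal_sqrt Y X ->
  (db_it Y k).1 = newton_it Y k /\ (db_it Y k).2 = invmx Y *m newton_it Y k.
Proof.
move=> pX; have uY : Y \in unitmx by exact: newton_it_unit 0 pX.
have uk j := newton_it_unit j pX.
(* Commutation turns [Y^-1 X_k^-1 Y] into [X_k^-1] in the second recurrence. *)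
have cY j : comm_mx Y (newton_it Y j).
  elim: j => [|j IH] //=; rewrite /comm_mx -scalemxAr -scalemxAl.
  congr (_ *: _); apply: comm_mxD => //; apply: comm_mxM => //.
  exact/comm_mx_sym/comm_mx_inv/comm_mx_sym.
elim: k => [|k [IH1 IH2]] /=; first by rewrite mulVmx.
have invZ : invmx (invmx Y *m newton_it Y k) = invmx (newton_it Y k) *m Y.
  by apply: invmx_uniq; rewrite -mulmxA mulKVmx // mulVmx.
rewrite IH1 IH2 invZ; split=> //; rewrite -scalemxAr mulmxDr; congr (_ *: (_ + _)).
by rewrite (comm_mx_inv (uk k) (comm_mx_sym (cY k))) mulKmx.
Qed.
End Newton.

(** * Perturbation of the principal square root *)

Section Perturbation.
Variable R : realType.
Local Notation C := (R[i]).

Lemma l1normM_le m n p (X : 'M[C]_(m, n)) (Y : 'M[C]_(n, p)) x y :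
  l1norm X <= x -> l1norm Y <= y -> l1norm (X *m Y) <= x * y.
Proof.
move=> Xx Yy; apply: le_trans (l1normM _ _) _.
by apply: ler_pM; rewrite ?l1norm_ge0.
Qed.

Lemma l1normD_le m n (X Y : 'M[C]_(m, n)) x y :
  l1norm X <= x -> l1norm Y <= y -> l1norm (X + Y) <= x + y.
Proof. by move=> Xx Yy; apply: le_trans (l1norm_triangle _ _) (lerD Xx Yy). Qed.

Lemma l1normB_le m n (X Y : 'M[C]_(m, n)) x y :
  l1norm X <= x -> l1norm Y <= y -> l1norm (X - Y) <= x + y.
Proof. by move=> Xx Yy; apply: l1normD_le; rewrite ?l1normN. Qed.

Lemma cvg_geometric_diff (a : nat -> R) c :
  (forall k, `|a k.+1 - a k| <= c * 2^-1 ^+ k) -> cvgn a.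
Proof.
move=> ac.
rewrite (_ : a = (fun n => a 0%N + series (telescope a) n)); last first.
  by apply/funext => n; exact: eq_sum_telescope.
apply: is_cvgD; first exact: is_cvg_cst.
apply: normed_cvg; apply: series_le_cvg (is_cvg_geometric_series _ (a := c) (z := 2^-1)).
- by move=> k; exact: normr_ge0.
- by move=> k; apply: le_trans (ac k).
- by move=> k; exact: ac.
- by rewrite ger0_norm ?invr_ge0 // invf_lt1 // ltr1n.
Qed.

(** Completeness is obtained from the real and imaginary parts of each entry, whose increments are
    dominated by a geometric series. *)
Lemma l1norm_complete n (u : nat -> 'M[C]_n) c :
  (forall k, l1norm (u k.+1 - u k) <= c * 2^-1 ^+ k) ->
  exists L, (l1norm (u k - L) @[k --> \oo] --> (0 : R))%classic.
Proof.
move=> uc.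
have cRe i j : cvgn (fun k => complex.Re (u k i j) : R).
  apply: (@cvg_geometric_diff _ c) => k; apply: le_trans (uc k).
  apply: le_trans (l1norm_entry _ i j); apply: le_trans (normRe_le _).
  by rewrite !mxE raddfB.
have cIm i j : cvgn (fun k => complex.Im (u k i j) : R).
  apply: (@cvg_geometric_diff _ c) => k; apply: le_trans (uc k).
  apply: le_trans (l1norm_entry _ i j); apply: le_trans (normIm_le _).
  by rewrite !mxE raddfB.
pose a i j := lim (complex.Re (u k i j) @[k --> \oo])%classic.
pose b i j := lim (complex.Im (u k i j) @[k --> \oo])%classic.
exists (\matrix_(i, j) (a i j +i* b i j)%C).
pose w k : R := \sum_(i < n) \sum_(j < n)
  (`|complex.Re (u k i j) - a i j| + `|complex.Im (u k i j) - b i j|).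
apply: (@squeeze_cvgr _ _ _ _ (fun=> 0) w).
- near=> k; rewrite l1norm_ge0 /=; do 2 apply: ler_sum => ? _.
  by apply: le_trans (normc_le _) _; rewrite !mxE !raddfB.
- exact: cvg_cst.
- have dist0 (f : nat -> R) : cvgn f ->
      (`|f k - lim (f @ \oo)%classic| @[k --> \oo] --> (0 : R))%classic.
    move=> cf; have -> : (0 : R) = `|lim (f @ \oo)%classic - lim (f @ \oo)%classic|.
      by rewrite subrr normr0.
    by apply: cvg_norm; apply: cvgB => //; exact: cvg_cst.
  have -> : (0 : R) = \sum_(i < n) \sum_(j < n) (0 + 0).
    by rewrite big1 // => i _; rewrite big1 // => j _; rewrite addr0.
  apply: cvg_big => [|i _]; first exact: add_continuous.
  apply: cvg_big => [|j _]; first exact: add_continuous.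
  by apply: cvgD; apply: dist0.
Unshelve. all: by end_near.
Qed.

Lemma linear_l1norm_bound n (T : {linear 'M[C]_n -> 'M[C]_n}) :
  exists2 c, 0 < c & forall W, l1norm (T W) <= c * l1norm W.
Proof.
have TZ a X : T (a *: X) = a *: T X by rewrite linearZ.
pose c := \sum_(i < n) \sum_(j < n) l1norm (T (delta_mx i j)).
have c0 : 0 <= c by do 2 apply: sumr_ge0 => ? _; exact: l1norm_ge0.
(* Adding one keeps the constant positive even for [T = 0]. *)
exists (c + 1) => [|W]; first by rewrite ltr_wpDl.
apply: (@le_trans _ _ (c * l1norm W)); last first.
  by rewrite ler_wpM2r ?l1norm_ge0 // lerDl.
rewrite {1}(matrix_sum_delta W) raddf_sum mulr_suml.
apply: le_trans (l1norm_sum _ _ _) _; apply: ler_sum => i _.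
rewrite raddf_sum mulr_suml.
apply: le_trans (l1norm_sum _ _ _) _; apply: ler_sum => j _.
rewrite [X in l1norm X](TZ (W i j) (delta_mx i j)) l1normZ mulrC ler_wpM2l ?l1norm_ge0 //.
exact: l1norm_entry.
Qed.

Lemma le0_of_cvg0 (a : R) (v : nat -> R) :
  (v k @[k --> \oo] --> (0 : R))%classic -> (forall k, a <= v k) -> a <= 0.
Proof.
move=> v0 av; apply: (@ler_cvg_to _ _ _ _ (fun=> a) v) v0 _.
  exact: cvg_cst.
by near=> k.
Unshelve. all: by end_near.
Qed.

(** Picard iteration from zero in the ball of radius [r = 2 c |F|]. The smallness of [F] gives
    [2 c r <= 1/2], which makes [phi] both a self-map of the ball and a contraction with factor
    [1/2]. *)
Lemma quadratic_fixpoint n (T : {linear 'M[C]_n -> 'M[C]_n}) c F :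
  0 < c -> (forall W, l1norm (T W) <= c * l1norm W) -> 8 * c ^+ 2 * l1norm F <= 1 ->
  exists2 D, l1norm D <= 2 * c * l1norm F & D = T (F - D *m D).
Proof.
move=> c0 Tc Fsmall; pose phi D := T (F - D *m D).
set f := l1norm F in Fsmall *; have f0 : 0 <= f by exact: l1norm_ge0.
pose r := 2 * c * f; have r0 : 0 <= r by rewrite /r !mulr_ge0 // ltW.
have cr : c * (r + r) <= 2^-1 by move: Fsmall; rewrite /r; lra.
have contr D D' : l1norm D <= r -> l1norm D' <= r ->
    l1norm (phi D - phi D') <= 2^-1 * l1norm (D - D').
  move=> Dr D'r; rewrite /phi -linearB; apply: le_trans (Tc _) _.
  have -> : F - D *m D - (F - D' *m D') = D' *m (D' - D) + (D' - D) *m D.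
    rewrite mulmxBr mulmxBl opprB addrC addrA.
    by apply/matrixP => i j; move: (D *m D) (D' *m D') (D' *m D) => P Q Q'; rewrite !mxE; ring.
  have E : l1norm (D' *m (D' - D) + (D' - D) *m D) <= (r + r) * l1norm (D - D').
    rewrite mulrDl {2}(mulrC r) (l1norm_distC D).
    by apply: l1normD_le; apply: l1normM_le.
  apply: le_trans (ler_wpM2l (ltW c0) E) _.
  by rewrite mulrA ler_wpM2r ?l1norm_ge0.
have phir D : l1norm D <= r -> l1norm (phi D) <= r.
  move=> Dr; apply: le_trans (Tc _) _.
  have E : l1norm (F - D *m D) <= f + r * r by apply: l1normB_le => //; exact: l1normM_le.
  apply: le_trans (ler_wpM2l (ltW c0) E) _.
  have : (c * (r + r)) * r <= 2^-1 * r by rewrite ler_wpM2r.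
  have -> : c * (f + r * r) = 2^-1 * r + 2^-1 * ((c * (r + r)) * r) by rewrite /r; field.
  by lra.
pose u k := iter k phi 0.
have ur k : l1norm (u k) <= r.
  by elim: k => [|k IH] /=; rewrite ?l1norm0 //; exact: phir.
have ucvg k : l1norm (u k.+1 - u k) <= r * 2^-1 ^+ k.
  elim: k => [|k IH]; first by rewrite subr0 mulr1; exact: ur.
  apply: (le_trans (contr (u k.+1) (u k) (ur k.+1) (ur k))).
  by rewrite exprS mulrCA ler_wpM2l ?invr_ge0.
have [D uD] := l1norm_complete ucvg.
have Dr : l1norm D <= r.
  rewrite -subr_le0; apply: (le0_of_cvg0 uD) => k; rewrite lerBlDr.
  have : l1norm (u k - (u k - D)) <= r + l1norm (u k - D) by exact: l1normB_le.
  by rewrite subKr addrC.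
exists D => //; apply/eqP; rewrite -subr_eq0; apply/eqP/l1norm_eq0.
pose v k := l1norm (u k.+1 - D) + 2^-1 * l1norm (u k - D).
apply: (@le0_of_cvg0 _ v).
  have shift : (l1norm (u k.+1 - D) @[k --> \oo] --> (0 : R))%classic.
    by rewrite (cvg_shiftS (fun k => l1norm (u k - D))).
  have := cvgD shift (cvgM (cvg_cst (2^-1 : R)) uD); rewrite mulr0 addr0.
  by apply.
move=> k; have -> : D - T (F - D *m D) = (phi (u k) - phi D) - (u k.+1 - D).
  have -> : u k.+1 = phi (u k) by [].
  rewrite -/(phi D); move: (phi (u k)) (phi D) => P Q.
  by apply/matrixP => i j; rewrite !mxE; ring.
rewrite /v [leRHS]addrC; apply: l1normB_le; last exact: lexx.
exact: (contr (u k) D (ur k) Dr).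
Qed.

(** If [v (V + P) = 0] then [v = - v P V^-1], so [|v| <= |v| / 2]. The same absorption in the
    resolvent identity yields the factor 2. *)
Lemma unitmx_perturb n (V P : 'M[C]_n) :
  V \in unitmx -> l1norm P * l1norm (invmx V) <= 2^-1 ->
  [/\ V + P \in unitmx,
      invmx (V + P) = invmx V - invmx (V + P) *m P *m invmx V &
      l1norm (invmx (V + P)) <= 2 * l1norm (invmx V)].
Proof.
move=> uV small.
have uVP : V + P \in unitmx.
  apply: unitmx_rowinj => v; rewrite mulmxDr => /eqP; rewrite addr_eq0 => /eqP vV.
  have vE : v = - (v *m (P *m invmx V)) by rewrite -{1}(mulmxK uV v) vV mulNmx mulmxA.
  apply: l1norm_eq0; have : l1norm v <= l1norm v * 2^-1.
    rewrite {1}vE l1normN; apply: l1normM_le => //.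
    by apply: le_trans (l1normM _ _) small.
  by lra.
have E : invmx (V + P) = invmx V - invmx (V + P) *m P *m invmx V.
  apply: (can_inj (mulmxK uV)); rewrite mulmxBl mulVmx // mulmxKV //.
  by rewrite -(mulVmx uVP) mulmxDr addrK.
split=> //; have : l1norm (invmx (V + P)) <=
    l1norm (invmx V) + l1norm (invmx (V + P)) * 2^-1.
  rewrite {1}E; apply: l1normB_le => //; rewrite -mulmxA; apply: l1normM_le => //.
  by apply: le_trans (l1normM _ _) small.
by lra.
Qed.

Lemma exp_lipschitz n (Q : 'M[C]_n) N : exists2 c, 0 <= c &
  forall P, l1norm (P - Q) <= 1 -> l1norm (P ^+ N - Q ^+ N) <= c * l1norm (P - Q).
Proof.
elim: N => [|N [c c0 IH]]; first by exists 0 => // P _; rewrite subrr l1norm0 mul0r.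
exists (c * (1 + l1norm Q) + l1norm (Q ^+ N)) => [|P PQ].
  by rewrite addr_ge0 ?mulr_ge0 ?addr_ge0 ?l1norm_ge0.
have -> : P ^+ N.+1 - Q ^+ N.+1 = (P ^+ N - Q ^+ N) *m P + Q ^+ N *m (P - Q).
  by rewrite !exprSrmx mulmxBl mulmxBr addrA subrK.
have Pn : l1norm P <= 1 + l1norm Q.
  by rewrite -(subrK Q P); apply: l1normD_le => //; rewrite subrK.
have -> : (c * (1 + l1norm Q) + l1norm (Q ^+ N)) * l1norm (P - Q) =
  c * l1norm (P - Q) * (1 + l1norm Q) + l1norm (Q ^+ N) * l1norm (P - Q) by ring.
by apply: l1normD_le; apply: l1normM_le => //; exact: IH.
Qed.

Lemma cayleyE n (X : 'M[C]_n) : X + 1%:M \in unitmx ->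
  cayley X = 1%:M - 2%:R *: invmx (X + 1%:M).
Proof.
move=> uX; apply: (can_inj (mulmxK uX)); rewrite mulmxKV // mulmxBl mul1mx.
by rewrite -scalemxAl mulVmx //; apply/matrixP => i j; rewrite !mxE; ring.
Qed.

(** Some power [N] of the Cayley transform has norm below [1/2]. The transform and its [N]-th power
    vary in a Lipschitz way near [S], so the perturbed power stays below one and [eigenvalue_cayley]
    applies. *)
Lemma spectrum_perturb n (S : 'M[C]_n) :
  (forall z, eigenvalue S z -> 0 < complex.Re z) ->
  exists2 d, 0 < d & forall D, l1norm D <= d ->
    forall z, eigenvalue (S + D) z -> 0 < complex.Re z.
Proof.
move=> specS; have uS := principal_addr1_unit specS.
have [c [r [_ r01 Gk]]] := powers_decay (fun g => @cayley_eigenvalue _ n S g specS).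
have half0 : (0 : R) < 2^-1 by rewrite invr_gt0.
have [N HN] := geometric_eventually_lt c r01 half0.
have GN : l1norm (cayley S ^+ N) < 2^-1 := le_lt_trans (Gk N) (HN N (leqnn N)).
have [l l0 Hl] := exp_lipschitz (cayley S) N.
set a := l1norm (invmx (S + 1%:M)); have a0 : 0 <= a by exact: l1norm_ge0.
pose b := 4 * a ^+ 2; have b0 : 0 <= b by rewrite mulr_ge0 ?sqr_ge0.
have den0 : 0 < 2 * (a + b + l * b) + 1.
  by rewrite ltr_wpDl // mulr_ge0 // !addr_ge0 // mulr_ge0.
(* This radius meets three demands: [d a <= 1/2] to invert [S + 1 + D], [d b <= 1] for
   [exp_lipschitz], and [l d b <= 1/2] for the final estimate. *)
set den := 2 * (a + b + l * b) + 1 in den0.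
exists (1 / den) => [|D]; first by rewrite divr_gt0.
rewrite (ler_pdivlMr _ _ den0) /den => Dsmall.
have D0 := l1norm_ge0 D; set d := l1norm D in Dsmall D0.
have da : 0 <= d * a by rewrite mulr_ge0.
have db : 0 <= d * b by rewrite mulr_ge0.
have dlb : 0 <= d * (l * b) by rewrite !mulr_ge0.
have [uSD E bnd] : [/\ (S + 1%:M) + D \in unitmx,
    invmx (S + 1%:M + D) =
      invmx (S + 1%:M) - invmx (S + 1%:M + D) *m D *m invmx (S + 1%:M) &
    l1norm (invmx (S + 1%:M + D)) <= 2 * l1norm (invmx (S + 1%:M))].
  by apply: unitmx_perturb => //; rewrite -/d -/a; lra.
have SD : S + D + 1%:M = S + 1%:M + D by rewrite addrAC.
move=> z; apply: (@eigenvalue_cayley _ _ _ N); first by rewrite SD; exact: uSD.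
have cdiff : l1norm (cayley (S + D) - cayley S) <= d * b.
  rewrite !cayleyE ?SD // E.
  have -> : 1%:M - 2%:R *: (invmx (S + 1%:M) -
      invmx (S + 1%:M + D) *m D *m invmx (S + 1%:M)) -
      (1%:M - 2%:R *: invmx (S + 1%:M)) =
      2%:R *: (invmx (S + 1%:M + D) *m D *m invmx (S + 1%:M)).
    move: (invmx (S + 1%:M + D) *m D *m invmx (S + 1%:M)) => W.
    by apply/matrixP => i j; rewrite !mxE; ring.
  rewrite l1normZ -(rmorph_nat (real_complex R)) normc_real normr_nat.
  have -> : d * b = 2 * (2 * a * d * a) by rewrite /b; ring.
  by rewrite ler_pM2l //; apply: l1normM_le => //; apply: l1normM_le.
have := Hl (cayley (S + D)); set G := cayley (S + D) in cdiff * => HG.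
have {}HG : l1norm (G ^+ N - cayley S ^+ N) <= l * (d * b).
  apply: le_trans (HG _) _; first by apply: le_trans cdiff _; lra.
  by rewrite ler_wpM2l.
rewrite -(subrK (cayley S ^+ N) (G ^+ N)).
apply: le_lt_trans (l1norm_triangle _ _) _; lra.
Qed.

(** Expanding the square, [(S + D)^2 = M + F] says [S D + D S = F - D^2], that is
    [D = T (F - D^2)]. *)
Lemma principal_sqrt_perturb n (M S : 'M[C]_n) : is_principal_sqrt M S ->
  exists (T : {linear 'M[C]_n -> 'M[C]_n}) (c d : R),
  [/\ 0 < c, 0 < d, forall W, S *m T W + T W *m S = W,
      forall W, l1norm (T W) <= c * l1norm W &
      forall F, l1norm F <= d -> exists D, [/\ l1norm D <= 2 * c * l1norm F,
        is_principal_sqrt (M + F) (S + D) & D = T (F - D *m D)]].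
Proof.
move=> pS; have [S2 specS] := pS.
have [T ST] := sylvester_solve (fun D => @principal_sylvester_inj _ n M M S S D pS pS).
have [c c0 Tc] := linear_l1norm_bound T.
have [d d0 Hd] := spectrum_perturb specS.
have c2 : 0 < 8 * c ^+ 2 by rewrite mulr_gt0 // exprn_gt0.
have c1 : 0 < 2 * c by rewrite mulr_gt0.
(* The first bound feeds the fixed point; the second keeps [|D| <= d], where the spectrum stays in
   the right half-plane. *)
exists T, c, (Num.min (1 / (8 * c ^+ 2)) (d / (2 * c))); split=> //.
  by rewrite lt_min !divr_gt0.
move=> F; rewrite le_min => /andP[F1 F2].
have [|D Dn DE] := quadratic_fixpoint c0 Tc (F := F).
  by rewrite mulrC -ler_pdivlMr.
exists D; split; [exact: Dn | split | exact: DE].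
  rewrite mulmxDl !mulmxDr S2 -addrA; congr (_ + _).
  have := ST (F - D *m D); rewrite -DE => /eqP; rewrite -subr_eq0 opprB => /eqP E.
  by apply/subr0_eq; rewrite -{}E; apply/matrixP => i j;
     move: (S *m D) (D *m S) (D *m D) => X Y Z; rewrite !mxE; ring.
apply: Hd; apply: (le_trans Dn).
by rewrite mulrC -ler_pdivlMr.
Qed.

End Perturbation.

(** * Second-order expansions and Frechet derivatives *)

Section Expansion.
Variable R : realType.
Local Notation C := (R[i]).

(** Here [I] stands for [S^-1], [V] for [(S + D)^-1] and [B] for the linear part [T F] of [D], so
    both terms on the right are of second order. *)
Lemma neumann_order2 n (V I D B : 'M[C]_n) : V = I - V *m D *m I ->
  V - (I - I *m B *m I) = V *m D *m I *m D *m I - I *m (D - B) *m I.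
Proof.
move=> VE; have E : V *m D *m I = I - V by rewrite {2}VE subKr.
rewrite E !mulmxBl E !(mulmxBl, mulmxBr).
move: (I *m D *m I) (I *m B *m I) => P Q.
by apply/matrixP => i j; rewrite !mxE; ring.
Qed.

(** Now [B - Q] is the second-order approximation of [D], and every term on the right is of third
    order. *)
Lemma neumann_order3 n (V I D B Q : 'M[C]_n) : V = I - V *m D *m I ->
  V - (I - I *m B *m I + (I *m B *m I *m B *m I + I *m Q *m I)) =
  I *m (D - B) *m I *m D *m I + I *m B *m I *m (D - B) *m I
  - I *m (D - (B - Q)) *m I - V *m D *m I *m D *m I *m D *m I.
Proof.
move=> VE; have E : V *m D *m I = I - V by rewrite {2}VE subKr.
rewrite E !mulmxBl E !(mulmxBl, mulmxBr) E.
move: (I *m B *m I *m B *m I) (I *m B *m I *m D *m I) (I *m D *m I *m D *m I).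
move: (I *m D *m I) (I *m B *m I) (I *m Q *m I) => P1 P2 P3 P4 P5 P6.
by apply/matrixP => i j; rewrite !mxE; ring.
Qed.

(** The quadratic estimates serve to identify the derivatives, the cubic ones to treat
    [F = i h E]. *)
Lemma principal_sqrt_expansion n (M S : 'M[C]_n) : is_principal_sqrt M S ->
  exists (T : {linear 'M[C]_n -> 'M[C]_n}) (d k : R),
  [/\ 0 < d, 0 <= k, forall W, S *m T W + T W *m S = W &
  forall F, l1norm F <= d -> exists X,
    [/\ is_principal_sqrt (M + F) X,
        l1norm (X - (S + T F)) <= k * l1norm F ^+ 2,
        l1norm (X - (S + T F - T (T F *m T F))) <= k * l1norm F ^+ 3,
        l1norm (invmx X - (invmx S - invmx S *m T F *m invmx S))
          <= k * l1norm F ^+ 2 &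
        l1norm (invmx X - (invmx S - invmx S *m T F *m invmx S
           + (invmx S *m T F *m invmx S *m T F *m invmx S
              + invmx S *m T (T F *m T F) *m invmx S))) <= k * l1norm F ^+ 3]].
Proof.
move=> pS; have uS := principal_sqrt_unit pS.
have [T [c [d [c0 d0 ST Tc HF]]]] := principal_sqrt_perturb pS.
set I := invmx S; set a := l1norm I; have a0 : 0 <= a by exact: l1norm_ge0.
(* These constants belong to the four estimates in order, and come from [|D| <= 2 c |F|],
   [|T F| <= c |F|] and [|(S + D)^-1| <= 2 a]. *)
pose k1 := 4 * c ^+ 3; pose k2 := 12 * c ^+ 5.
pose k3 := 8 * a ^+ 3 * c ^+ 2 + 4 * a ^+ 2 * c ^+ 3.
pose k4 := 12 * a ^+ 2 * c ^+ 5 + 12 * a ^+ 3 * c ^+ 4 + 16 * a ^+ 4 * c ^+ 3.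
have k1_0 : 0 <= k1 by rewrite /k1 mulr_ge0 ?exprn_ge0 // ltW.
have k2_0 : 0 <= k2 by rewrite /k2 mulr_ge0 ?exprn_ge0 // ltW.
have k3_0 : 0 <= k3 by rewrite /k3 !addr_ge0 // !mulr_ge0 ?exprn_ge0 // ltW.
have k4_0 : 0 <= k4 by rewrite /k4 !addr_ge0 // !mulr_ge0 ?exprn_ge0 // ltW.
(* Ensures [2 c |F| a <= 1/2], the smallness needed to invert [S + D]. *)
pose den := 4 * c * a + 1.
have den0 : 0 < den by rewrite /den ltr_wpDl // !mulr_ge0 // ltW.
exists T, (Num.min d (1 / den)), (k1 + k2 + k3 + k4); split.
- by rewrite lt_min d0 divr_gt0.
- exact: addr_ge0 (addr_ge0 (addr_ge0 k1_0 k2_0) k3_0) k4_0.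
- exact: ST.
move=> F; rewrite le_min => /andP[Fd]; rewrite (ler_pdivlMr _ _ den0) /den => Fa.
have [D [Dn pX DE]] := HF F Fd.
set f := l1norm F in Fd Fa Dn *; have f0 : 0 <= f by exact: l1norm_ge0.
have TF : l1norm (T F) <= c * f by exact: Tc.
have DTF : l1norm (D - T F) <= k1 * f ^+ 2.
  have -> : D - T F = T (- (D *m D)) by rewrite {1}DE raddfB raddfN addrAC subrr sub0r.
  have DD : l1norm (D *m D) <= (2 * c * f) * (2 * c * f) by exact: l1normM_le.
  apply: le_trans (Tc _) _; rewrite l1normN; apply: le_trans (ler_wpM2l (ltW c0) DD) _.
  by rewrite le_eqVlt; apply/orP; left; apply/eqP; rewrite /k1; ring.
(* Feeding the first-order estimate back into the fixed-point equation gains one order. *)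
have DTF2 : l1norm (D - (T F - T (T F *m T F))) <= k2 * f ^+ 3.
  have -> : D - (T F - T (T F *m T F)) = T (- ((D - T F) *m T F + D *m (D - T F))).
    rewrite {1}DE -!raddfB; congr (T _); rewrite mulmxBl mulmxBr.
    by move: (D *m D) (T F *m T F) (D *m T F) => P Q Q';
       apply/matrixP => i j; rewrite !mxE; ring.
  have B : l1norm ((D - T F) *m T F + D *m (D - T F)) <=
      k1 * f ^+ 2 * (c * f) + 2 * c * f * (k1 * f ^+ 2).
    by apply: l1normD_le; apply: l1normM_le.
  apply: le_trans (Tc _) _; rewrite l1normN; apply: le_trans (ler_wpM2l (ltW c0) B) _.
  by rewrite le_eqVlt; apply/orP; left; apply/eqP; rewrite /k1 /k2; ring.
have [uX XE Xn] : [/\ S + D \in unitmx, invmx (S + D) = I - invmx (S + D) *m D *m I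
    & l1norm (invmx (S + D)) <= 2 * a].
  apply: unitmx_perturb => //; rewrite -/I -/a.
  by apply: le_trans (ler_wpM2r a0 Dn) _; lra.
set V := invmx (S + D) in XE Xn.
have f20 : 0 <= f ^+ 2 by exact: exprn_ge0.
have f30 : 0 <= f ^+ 3 by exact: exprn_ge0.
have lek1 : k1 <= k1 + k2 + k3 + k4 by lra.
have lek2 : k2 <= k1 + k2 + k3 + k4 by lra.
have lek3 : k3 <= k1 + k2 + k3 + k4 by lra.
have lek4 : k4 <= k1 + k2 + k3 + k4 by lra.
exists (S + D); split; first exact: pX.
- apply: le_trans (ler_wpM2r f20 lek1).
  by rewrite opprD addrACA subrr add0r.
- apply: le_trans (ler_wpM2r f30 lek2).
  by rewrite -[S + T F - _]addrA [- (S + _)]opprD addrACA subrr add0r.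
- apply: le_trans (ler_wpM2r f20 lek3); rewrite -/V.
  rewrite (neumann_order2 (T F) XE).
  have -> : k3 * f ^+ 2 = 2 * a * (2 * c * f) * a * (2 * c * f) * a
      + a * (k1 * f ^+ 2) * a by rewrite /k3 /k1; ring.
  by apply: l1normB_le; do !apply: l1normM_le.
- apply: le_trans (ler_wpM2r f30 lek4); rewrite -/V.
  set Q := T (T F *m T F) in DTF2 *.
  rewrite (neumann_order3 (T F) Q XE).
  have -> : k4 * f ^+ 3 = a * (k1 * f ^+ 2) * a * (2 * c * f) * a
      + a * (c * f) * a * (k1 * f ^+ 2) * a + a * (k2 * f ^+ 3) * a
      + 2 * a * (2 * c * f) * a * (2 * c * f) * a * (2 * c * f) * a.
    by rewrite /k4 /k1 /k2; ring.
  by apply: l1normB_le; [apply: l1normB_le; [apply: l1normD_le|]|]; do !apply: l1normM_le.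
Qed.

(** A quadratic remainder is little-o, and norm equivalence carries this to the max norm; a linear
    map on matrices is continuous because it is bounded on the matrix units. *)
Lemma diff_of_quadratic n (f : 'M[R]_n -> 'M[R]_n) (L : {linear 'M[R]_n -> 'M[R]_n})
    (A : 'M[R]_n) c d : 0 < d -> 0 <= c ->
  (forall F, l1norm (cmx F) <= d ->
     l1norm (cmx (f (A + F) - (f A + L F))) <= c * l1norm (cmx F) ^+ 2) ->
  'd f A = L :> ('M[R]_n -> 'M[R]_n).
Proof.
move=> d0 c0 fL; pose m : R := (n ^ 2)%:R; have m0 : 0 <= m by exact: ler0n.
have mP (F : 'M[R]_n) : l1norm (cmx F) <= m * `|F| by exact: l1norm_cmx_le.
have m10 : 0 < m + 1 by rewrite ltr_wpDl.
apply: diff_unique.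
  apply/linear_bounded_continuous/linear_boundedP.
  pose b : R := \sum_(i < n) \sum_(j < n) `|L (delta_mx i j)|.
  have LZ x W : L (x *: W) = x *: L W by rewrite linearZ.
  near=> r => W; apply: (@le_trans _ _ (b * `|W|)); last first.
    by rewrite ler_wpM2r.
  rewrite {1}(matrix_sum_delta W) raddf_sum mulr_suml.
  apply: le_trans (ler_norm_sum _ _ _) _; apply: ler_sum => i _.
  rewrite raddf_sum mulr_suml.
  apply: le_trans (ler_norm_sum _ _ _) _; apply: ler_sum => j _.
  rewrite [X in `|X|](LZ (W i j) (delta_mx i j)) normrZ mulrC ler_wpM2l //.
  exact: norm_entry_le.
apply/eqaddoP => e e0; apply: (iffRL (@nbhs_norm0P _ 'M[R]_n _)).
(* The first radius makes the hypothesis applicable, the second makes [c m^2 |F| <= e]. *)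
exists (Num.min (d / (m + 1)) (e / (c * m ^+ 2 + 1))) => [|F /=].
  by rewrite /= lt_min !divr_gt0 // ltr_wpDl // mulr_ge0 // exprn_ge0.
rewrite lt_min => /andP[F1 F2].
have den0 : 0 < c * m ^+ 2 + 1 by rewrite ltr_wpDl // mulr_ge0 // exprn_ge0.
have Fd : l1norm (cmx F) <= d.
  move: F1; rewrite (ltr_pdivlMr _ _ m10) => F1; apply: le_trans (mP F) _.
  by apply: le_trans (ltW F1); rewrite mulrC ler_wpM2l // lerDl.
move: F2; rewrite (ltr_pdivlMr _ _ den0) => F2.
apply: le_trans (norm_le_l1norm_cmx _) _.
have fLF := fL F Fd; rewrite [A + F]addrC in fLF; apply: (le_trans fLF).
have F0 := normr_ge0 F.
have : l1norm (cmx F) ^+ 2 <= (m * `|F|) ^+ 2.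
  by apply: lerXn2r; rewrite ?nnegrE ?l1norm_ge0 ?mulr_ge0.
move=> /(ler_wpM2l c0) /le_trans; apply.
have -> : c * (m * `|F|) ^+ 2 = (`|F| * (c * m ^+ 2)) * `|F| by ring.
rewrite ler_wpM2r // (le_trans _ (ltW F2)) // ler_wpM2l // lerDl //.
Unshelve. all: by end_near.
Qed.

End Expansion.

(** * The perturbation [i h E] and the limits of the iterations *)

Section Final.
Variable R : realType.
Local Notation C := (R[i]).

Lemma cmx_inj n : injective (@cmx R n).
Proof.
move=> X Y /matrixP XY; apply/matrixP => i j.
by have /(congr1 (@complex.Re R)) := XY i j; rewrite !mxE.
Qed.

Lemma cmxM n (X Y : 'M[R]_n) : cmx (X *m Y) = cmx X *m cmx Y.
Proof. exact: (map_mxM (real_complex R)). Qed.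

Lemma cmxD n (X Y : 'M[R]_n) : cmx (X + Y) = cmx X + cmx Y.
Proof. exact: (map_mxD (real_complex R)). Qed.

Lemma cmxB n (X Y : 'M[R]_n) : cmx (X - Y) = cmx X - cmx Y.
Proof. exact: (map_mxB (real_complex R)). Qed.

Lemma cmxN n (X : 'M[R]_n) : cmx (- X) = - cmx X.
Proof. exact: (map_mxN (real_complex R)). Qed.

Lemma cmx0 n : cmx (0 : 'M[R]_n) = 0.
Proof. exact: (map_mx0 (real_complex R)). Qed.

Lemma cmx_inv n (X : 'M[R]_n) : cmx (invmx X) = invmx (cmx X).
Proof. exact: (map_invmx (real_complex R)). Qed.

Lemma cmxZ n (a : R) (X : 'M[R]_n) : cmx (a *: X) = (a%:C)%C *: cmx X.
Proof. exact: (map_mxZ (real_complex R)). Qed.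

(** As [(i h)^2 = - h^2], the matrix [q] enters the real part only. The imaginary part carries just
    the cubic remainder, which division by [h] turns into [O(h^2)]. *)
Lemma expansion_parts n (X : 'M[C]_n) (s l q : 'M[R]_n) (k h : R) :
    0 < h -> h <= 1 -> 0 <= k ->
    l1norm (X - (cmx s + ('i%C * h%:C)%C *: cmx l + ('i%C * h%:C)%C ^+ 2 *: cmx q))
      <= k * h ^+ 3 ->
  frob (Remx X - s) <= (l1norm (cmx q) + k) * h ^+ 2 /\
  frob (Immx (((h%:C)%C)^-1 *: X) - l) <= (l1norm (cmx q) + k) * h ^+ 2.
Proof.
move=> h0 h1 k0; set W := X - _ => Wh.
have q0 := l1norm_ge0 (cmx q); have hn0 : h != 0 by rewrite gt_eqF.
have hk : k * h ^+ 3 <= k * h ^+ 2.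
  by rewrite ler_wpM2l // exprSr ler_piMr ?exprn_ge0 // ltW.
have ReE : Remx X - s = Remx W - h ^+ 2 *: q.
  apply/matrixP => i j; rewrite /W !mxE expr2.
  by case: (X i j) => a b /=; ring.
have ImE : Immx (((h%:C)%C)^-1 *: X) - l = h^-1 *: Immx W.
  apply/matrixP => i j; rewrite /W !mxE expr2.
  case: (X i j) => a b /=; field.
  by rewrite hn0.
split; apply: le_trans (frob_le_l1norm _) _.
  rewrite ReE cmxB cmxZ mulrDl [leRHS]addrC; apply: l1normB_le.
    by apply: le_trans (l1norm_cmx_Re W) _; apply: le_trans Wh hk.
  by rewrite l1normZ normc_real ger0_norm ?exprn_ge0 ?(ltW h0) // mulrC.
rewrite ImE cmxZ l1normZ normc_real ger0_norm ?invr_ge0 ?(ltW h0) //.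
have := le_trans (l1norm_cmx_Im W) Wh.
rewrite -(ler_pM2l (x := h^-1)) ?invr_gt0 // => /le_trans; apply.
have -> : h^-1 * (k * h ^+ 3) = k * h ^+ 2 by field; rewrite hn0.
by rewrite ler_wpM2r ?exprn_ge0 ?lerDr // ltW.
Qed.

(** Applied to scaling by [1 / h] and to left multiplication by [Y0^-1]. *)
Lemma l1norm_cvg_lipschitz n (phi : 'M[C]_n -> 'M[C]_n) c (u : nat -> 'M[C]_n) L :
  (forall X Y, l1norm (phi X - phi Y) <= c * l1norm (X - Y)) ->
  (l1norm (u k - L) @[k --> \oo] --> (0 : R))%classic ->
  (l1norm (phi (u k) - phi L) @[k --> \oo] --> (0 : R))%classic.
Proof.
move=> phic uL.
apply: (@squeeze_cvgr _ _ _ _ (fun=> 0) (fun k => c * l1norm (u k - L))).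
- by near=> k; rewrite l1norm_ge0 phic.
- exact: cvg_cst.
- by have := cvgM (cvg_cst (c : R)) uL; rewrite mulr0; apply.
Unshelve. all: by end_near.
Qed.

Lemma mx_cvg_of_l1norm n (u : nat -> 'M[C]_n) (L : 'M[C]_n) (g : C -> R) :
  (forall z w, `|g z - g w| <= normc (z - w)) ->
  (l1norm (u k - L) @[k --> \oo] --> (0 : R))%classic ->
  mx_cvg (fun k => map_mx g (u k)) (map_mx g L).
Proof.
move=> gP uL i j; apply/subr_cvg0; apply/norm_cvg0P.
apply: (@squeeze_cvgr _ _ _ _ (fun=> 0) (fun k => l1norm (u k - L))) => //.
- near=> k; rewrite normr_ge0 /= !mxE; apply: le_trans (gP _ _) _.
  by apply: le_trans (l1norm_entry _ i j); rewrite !mxE.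
- exact: cvg_cst.
Unshelve. all: by end_near.
Qed.

(** The bound [K] is left free so that several sequences can share one constant. *)
Lemma limit_parts n (u : nat -> 'M[C]_n) X (s l q : 'M[R]_n) (k K h : R) :
    0 < h -> h <= 1 -> 0 <= k -> l1norm (cmx q) + k <= K ->
    l1norm (X - (cmx s + ('i%C * h%:C)%C *: cmx l + ('i%C * h%:C)%C ^+ 2 *: cmx q))
      <= k * h ^+ 3 ->
    (l1norm (u j - X) @[j --> \oo] --> (0 : R))%classic ->
  (exists L, mx_cvg (fun j => Remx (u j)) L /\ frob (L - s) <= K * h ^+ 2) /\
  (exists L, mx_cvg (fun j => Immx (((h%:C)%C)^-1 *: u j)) L /\
             frob (L - l) <= K * h ^+ 2).
Proof.
move=> h0 h1 k0 qK Xh uX; have [ReX ImX] := expansion_parts h0 h1 k0 Xh.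
have qKh : (l1norm (cmx q) + k) * h ^+ 2 <= K * h ^+ 2.
  by rewrite ler_wpM2r // exprn_ge0 // ltW.
split.
  exists (Remx X); split; last exact: le_trans ReX qKh.
  apply: mx_cvg_of_l1norm uX => z w; rewrite -raddfB; exact: normRe_le.
exists (Immx (((h%:C)%C)^-1 *: X)); split; last exact: le_trans ImX qKh.
apply: mx_cvg_of_l1norm => [z w|]; first by rewrite -raddfB; exact: normIm_le.
apply: (l1norm_cvg_lipschitz (c := normc ((h%:C)%C)^-1)) uX => Y Z.
by rewrite -scalerBr l1normZ.
Qed.

Lemma sqrtm_principal n (A : 'M[R]_n) :
  no_eig_nonpos A -> is_principal_sqrt (cmx A) (cmx (sqrtm A)).
Proof.
by move=> /principal_sqrt_exists[S pS]; rewrite (sqrtmE pS).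
Qed.

Lemma sqrtm_expansion n (A E : 'M[R]_n) : no_eig_nonpos A ->
  exists (q q' : 'M[R]_n) (k h0 : R), [/\ 0 < h0, h0 <= 1, 0 <= k &
  forall h, 0 < h -> h < h0 -> let e := ('i%C * h%:C)%C in exists X : 'M[C]_n,
    [/\ is_principal_sqrt (cmx A + e *: cmx E) X,
        l1norm (X - (cmx (sqrtm A) + e *: cmx ('d (@sqrtm R n) A E)
          + e ^+ 2 *: cmx q)) <= k * h ^+ 3 &
        l1norm (invmx X - (cmx (invsqrtm A) + e *: cmx ('d (@invsqrtm R n) A E)
          + e ^+ 2 *: cmx q')) <= k * h ^+ 3]].
Proof.
move=> specA; have pS := sqrtm_principal specA.
set s := sqrtm A in pS *; set si := invsqrtm A.
have siE : cmx si = invmx (cmx s) by rewrite /si /invsqrtm cmx_inv.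
have [T [d [k [d0 k0 ST HF]]]] := principal_sqrt_expansion pS.
have inj D : cmx s *m D + D *m cmx s = 0 -> D = 0 := @principal_sylvester_inj _ _ _ _ _ _ D pS pS.
(* The real Sylvester operator inherits injectivity from the complex one. By [TL] its inverse [L] is
   the restriction of [T], so the expansion has real coefficients. *)
have [L sL] : exists L : {linear 'M[R]_n -> 'M[R]_n}, forall W, s *m L W + L W *m s = W.
  apply: sylvester_solve => D sD; apply: cmx_inj; rewrite cmx0.
  by apply: inj; rewrite -!cmxM -cmxD sD cmx0.
have TL W : T (cmx W) = cmx (L W).
  apply/subr0_eq; apply: inj; rewrite mulmxBr mulmxBl -!cmxM addrACA ST.
  by rewrite -opprD -cmxD sL subrr.
have dsqrt : 'd (@sqrtm R n) A = L :> ('M[R]_n -> 'M[R]_n).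
  apply: (diff_of_quadratic d0 k0) => F /HF[X [pX X1 _ _ _]].
  have XE : cmx (sqrtm (A + F)) = X by apply: sqrtmE; rewrite cmxD; exact: pX.
  by rewrite cmxB cmxD -(TL F) XE; exact: X1.
(* The expected derivative of the inverse root, [W |-> - A^(-1/2) L(W) A^(-1/2)]. *)
pose L' : {linear 'M[R]_n -> 'M[R]_n} := mulmxr si \o (mulmx (- si) \o L).
have dinv : 'd (@invsqrtm R n) A = L' :> ('M[R]_n -> 'M[R]_n).
  apply: (diff_of_quadratic d0 k0) => F /HF[X [pX _ _ X1 _]].
  have XE : cmx (sqrtm (A + F)) = X by apply: sqrtmE; rewrite cmxD; exact: pX.
  have L'E : cmx (L' F) = - (invmx (cmx s) *m T (cmx F) *m invmx (cmx s)).
    by rewrite /L' /= !cmxM cmxN -(TL F) siE !mulNmx.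
  by rewrite cmxB cmxD L'E siE /invsqrtm cmx_inv XE; exact: X1.
(* The coefficients of [e^2] in the expansions of [X] and [X^-1] at [F = e E]. *)
pose q := - L (L E *m L E).
pose q' := si *m L E *m si *m L E *m si + si *m L (L E *m L E) *m si.
pose f := l1norm (cmx E); have f0 : 0 <= f by exact: l1norm_ge0.
have f10 : 0 < f + 1 by rewrite ltr_wpDl.
(* Since [|F| = h f], the cubic remainder brings out [f^3]; the denominator [f + 1] allows
   [E = 0]. *)
exists q, q', (k * f ^+ 3), (Num.min 1 (d / (f + 1))); split.
- by rewrite lt_min ltr01 divr_gt0.
- by rewrite ge_min lexx.
- by rewrite mulr_ge0 ?exprn_ge0.
move=> h h0; rewrite lt_min => /andP[h1]; rewrite (ltr_pdivlMr _ _ f10) => hf.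
set e := ('i%C * h%:C)%C => /=.
have Fn : l1norm (e *: cmx E) = h * f.
  rewrite l1normZ normcM normc_real gtr0_norm //.
  by rewrite [normc _](_ : _ = 1) ?mul1r //= expr0n expr1n add0r sqrtr1.
have TZ a W : T (a *: W) = a *: T W by rewrite linearZ.
have TF : T (e *: cmx E) = e *: cmx (L E) by rewrite (TZ e (cmx E)) TL.
have TT : T (T (e *: cmx E) *m T (e *: cmx E)) = e ^+ 2 *: cmx (L (L E *m L E)).
  by rewrite TF -scalemxAl -scalemxAr scalerA -cmxM TZ TL.
have [|X [pX _ X2 _ X3]] := HF (e *: cmx E).
  by rewrite Fn; apply: le_trans (ltW hf); rewrite ler_wpM2l ?lerDl // ltW.
have kE : k * (h * f) ^+ 3 = k * f ^+ 3 * h ^+ 3 by ring.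
exists X; split; first exact: pX.
- move: X2; rewrite TT TF Fn kE dsqrt /q cmxN scalerN; exact: id.
- move: X3; rewrite TT TF Fn kE dinv /q' cmxD /L' /=.
  rewrite !cmxM cmxN siE !mulNmx scalerN scalerDr.
  by rewrite -!(scalemxAr, scalemxAl) !scalerA -expr2.
Qed.

End Final.

Theorem theorem3 (R : realType) (n : nat) (A E : 'M[R]_n) :
  no_eig_nonpos A ->
  (* Part 1: Newton iteration started at A + i h E *)
  (exists (K h0 : R), 0 < h0 /\
    forall h : R, 0 < h -> h < h0 ->
      let X0 := cmx A + ('i%C * h%:C)%C *: cmx E in
      (forall k, newton_it X0 k \in unitmx) /\
      (exists L, mx_cvg (fun k => Remx (newton_it X0 k)) L /\
                 frob (L - sqrtm A) <= K * h ^+ 2) /\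
      (exists L, mx_cvg (fun k => Immx (((h%:C)%C)^-1 *: newton_it X0 k)) L /\
                 frob (L - 'd (@sqrtm R n) A E) <= K * h ^+ 2)) /\
  (* Part 2: coupled (Denman--Beavers) iteration *)
  (exists (K h0 : R), 0 < h0 /\
    forall h : R, 0 < h -> h < h0 ->
      let Y0 := cmx A + ('i%C * h%:C)%C *: cmx E in
      (forall k, (db_it Y0 k).1 \in unitmx /\ (db_it Y0 k).2 \in unitmx) /\
      (exists L, mx_cvg (fun k => Remx (db_it Y0 k).1) L /\
                 frob (L - sqrtm A) <= K * h ^+ 2) /\
      (exists L, mx_cvg (fun k => Remx (db_it Y0 k).2) L /\
                 frob (L - invsqrtm A) <= K * h ^+ 2) /\
      (exists L, mx_cvg (fun k => Immx (((h%:C)%C)^-1 *: (db_it Y0 k).1)) L /\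
                 frob (L - 'd (@sqrtm R n) A E) <= K * h ^+ 2) /\
      (exists L, mx_cvg (fun k => Immx (((h%:C)%C)^-1 *: (db_it Y0 k).2)) L /\
                 frob (L - 'd (@invsqrtm R n) A E) <= K * h ^+ 2)).
Proof.
move=> specA; have [q [q' [k [h0 [h00 h01 k0 HX]]]]] := sqrtm_expansion E specA.
split.
  exists (l1norm (cmx q) + k), h0; split=> // h hpos hlt X0.
  have [X [pX Xh _]] := HX h hpos hlt.
  have h1 : h <= 1 by exact: le_trans (ltW hlt) h01.
  split; first by move=> j; exact: newton_it_unit pX.
  exact: limit_parts hpos h1 k0 (lexx _) Xh (newton_cvg pX).
exists (l1norm (cmx q) + l1norm (cmx q') + k), h0; split=> // h hpos hlt Y0.
have [X [pX Xh X'h]] := HX h hpos hlt.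
have h1 : h <= 1 by exact: le_trans (ltW hlt) h01.
have uX := principal_sqrt_unit pX.
have uY0 : Y0 \in unitmx by exact: newton_it_unit 0 pX.
have db1 j : (db_it Y0 j).1 = newton_it Y0 j by have [] := db_it_newton j pX.
have db2 j : (db_it Y0 j).2 = invmx Y0 *m newton_it Y0 j by have [] := db_it_newton j pX.
have cvg1 : (l1norm ((db_it Y0 j).1 - X) @[j --> \oo] --> (0 : R))%classic.
  by under eq_fun do rewrite db1; exact: newton_cvg.
have cvg2 : (l1norm ((db_it Y0 j).2 - invmx X) @[j --> \oo] --> (0 : R))%classic.
  (* Because [X^2 = Y0], the limit [Y0^-1 X] of the second sequence is [X^-1]. *)
  have -> : invmx X = invmx Y0 *m X.
    apply: (can_inj (mulKmx uY0)); rewrite mulKVmx // /Y0.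
    by case: pX => <- _; rewrite mulmxK.
  under eq_fun do rewrite db2.
  apply: (l1norm_cvg_lipschitz (c := l1norm (invmx Y0))) (newton_cvg pX) => Y Z.
  by rewrite -mulmxBr l1normM.
have q0 := l1norm_ge0 (cmx q); have q'0 := l1norm_ge0 (cmx q').
have qK : l1norm (cmx q) + k <= l1norm (cmx q) + l1norm (cmx q') + k.
  by rewrite lerD2r lerDl.
have q'K : l1norm (cmx q') + k <= l1norm (cmx q) + l1norm (cmx q') + k.
  by rewrite lerD2r lerDr.
have [Re1 Im1] := limit_parts hpos h1 k0 qK Xh cvg1.
have [Re2 Im2] := limit_parts hpos h1 k0 q'K X'h cvg2.
split=> [j|]; last exact: (conj Re1 (conj Re2 (conj Im1 Im2))).
by rewrite db1 db2 unitmx_mul unitmx_inv uY0 (newton_it_unit j pX).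
Qed.
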